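(* For all positive coprime integers $p_0$ and $q_0$, $$\left| S\left(\frac{p_0}{q_0}\right)\right| \leq \frac{4\pi}{q_0}.$$
   Context: For real $\alpha$ and $\theta\in[0,1)$, let $H_{\alpha,\theta}$ be the bounded self-adjoint operator on $\ell^2(\mathbb{Z})$ (critical almost Mathieu operator) given by $$(H_{\alpha,\theta}\varphi)(n)=\varphi(n-1)+\varphi(n+1)+2\cos\bigl(2\pi(\alpha n+\theta)\bigr)\varphi(n),\qquad n\in\mathbb{Z}.$$ Let $\sigma(H)$ denote the spectrum of an operator $H$ (as a set), and define $$S(\alpha):=\bigcup_{\theta\in[0,1)}\sigma(H_{\alpha,\theta}).$$ (This set coincides with the spectrum of the discrete magnetic Laplacian $H(\alpha)$ on $\ell^2(\mathbb{Z}^2)$, $(H(\alpha)\psi)_{m,n}=\psi_{m,n-1}+\psi_{m,n+1}+e^{-i2\pi\alpha n}\psi_{m-1,n}+e^{i2\pi\alpha n}\psi_{m+1,n}$.) For a measurable set $A\subseteq\mathbb{R}$, $|A|$ denotes its Lebesgue measure. *)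

(* Defs.v *)
From HB Require Import structures.
From mathcomp Require Import all_boot all_order all_algebra.
From mathcomp Require Import complex.
From mathcomp Require Import all_classical all_reals all_analysis.
From mathcomp Require Import ring lra.

Set Implicit Arguments.
Unset Strict Implicit.
Unset Printing Implicit Defensive.

Import Order.TTheory GRing.Theory Num.Theory.
Import numFieldNormedType.Exports.
Import ComplexField.Normc.

Local Open Scope classical_set_scope.
Local Open Scope ring_scope.
Local Open Scope complex_scope.

(* [normc z : R] is the modulus of [z : R[i]]; the generic [`|z|] is the same
   number seen in R[i]. *)
Section SquareSum.
Context {R : realType}.
Implicit Types (f g : int -> R[i]) (z : R[i]).

Definition sqsum f : \bar R :=
  (\esum_(n in [set: int]) (normc (f n) ^+ 2)%:E)%E.

Lemma normc_realM (x : R) z : normc (x%:C * z) = `|x| * normc z.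
Proof. by rewrite normcM /= expr0n addr0 sqrtr_sqr. Qed.

Lemma normc_pos z : 0 <= normc z.
Proof. by case: z => a b; rewrite sqrtr_ge0. Qed.

Lemma normcD_le z1 z2 : normc (z1 + z2) <= normc z1 + normc z2.
Proof.
have := ler_normD z1 z2; rewrite !normc_def -rmorphD lecR.
by case: z1 z2 => [a b] [c d].
Qed.

Lemma sqsum_ge0 f : (0 <= sqsum f)%E.
Proof. by apply: esum_ge0 => n _; rewrite lee_fin sqr_ge0. Qed.

Lemma esumZ_le (c : R) (a : int -> R) : 0 <= c -> (forall n, 0 <= a n) ->
  (\esum_(n in [set: int]) (c * a n)%:E <=
   c%:E * \esum_(n in [set: int]) (a n)%:E)%E.
Proof.
move=> c0 a0; apply: ge_ereal_sup => _ [F [finF _] <-].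
under eq_fsbigr do rewrite EFinM.
rewrite -ge0_mule_fsumr; last by move=> n; rewrite lee_fin.
rewrite lee_wpmul2l ?lee_fin//.
by apply: ereal_sup_ubound; exists F.
Qed.

Lemma sqsum_le (c : R) f g : 0 <= c ->
  (forall n, normc (g n) ^+ 2 <= c * normc (f n) ^+ 2) ->
  (sqsum g <= c%:E * sqsum f)%E.
Proof.
move=> c0 gf; apply: (le_trans _ (esumZ_le c0 _)) => [|n]; last exact: sqr_ge0.
by apply: le_esum => n _; rewrite lee_fin.
Qed.

Lemma sqsum_shift (a : int) f : sqsum (fun n => f (n + a)) = sqsum f.
Proof.
rewrite /sqsum [RHS](@reindex_esum _ _ _ setT setT (fun n => n + a))//.
split => //; first by move=> x y _ _; exact: addIr.
by move=> y _; exists (y - a) => //; rewrite subrK.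
Qed.

Lemma sqsumD_le (s : R) f g : 0 < s ->
  (sqsum (f + g)%R <= (1 + s)%:E * sqsum f + (1 + s^-1)%:E * sqsum g)%E.
Proof.
move=> s0; have sV0 : 0 < s^-1 by rewrite invr_gt0.
have sq0 (h : int -> R[i]) n : 0 <= normc (h n) ^+ 2 by exact: sqr_ge0.
have s1 : 0 <= 1 + s by rewrite addr_ge0// ltW.
have sV1 : 0 <= 1 + s^-1 by rewrite addr_ge0// ltW.
apply: (le_trans _ (leeD (esumZ_le s1 (sq0 f)) (esumZ_le sV1 (sq0 g)))).
rewrite -esumD; first last.
- by move=> n _; rewrite lee_fin mulr_ge0.
- by move=> n _; rewrite lee_fin mulr_ge0.
apply: le_esum => n _; rewrite -EFinD lee_fin.
have -> : (f + g)%R n = f n + g n by [].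
have := normcD_le (f n) (g n).
move: (normc _) (normc_pos (f n + g n)) => u u0.
move: (normc _) (normc_pos (f n)) => x x0.
move: (normc _) (normc_pos (g n)) => y y0 uxy.
apply: (@le_trans _ _ ((x + y) ^+ 2)); first by rewrite ler_sqr ?nnegrE ?addr_ge0.
rewrite -subr_ge0.
have -> : (1 + s) * x ^+ 2 + (1 + s^-1) * y ^+ 2 - (x + y) ^+ 2 =
    s^-1 * (s * x - y) ^+ 2.
  by field; rewrite gt_eqF.
by rewrite mulr_ge0 ?sqr_ge0// ltW.
Qed.

Definition square_summable : {pred int -> R[i]} :=
  [pred f | (sqsum f < +oo)%E].

Lemma square_summable_le (c : R) f g : 0 <= c ->
  (forall n, normc (g n) ^+ 2 <= c * normc (f n) ^+ 2) ->
  f \in square_summable -> g \in square_summable.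
Proof.
rewrite !inE => c0 gf fl; apply: (le_lt_trans (sqsum_le c0 gf)).
by rewrite lte_mul_pinfty ?lee_fin// ge0_fin_numE// sqsum_ge0.
Qed.

Lemma square_summable_shift (a : int) f :
  f \in square_summable -> (fun n => f (n + a)) \in square_summable.
Proof. by rewrite !inE sqsum_shift. Qed.

Lemma square_summable_submod : submod_closed square_summable.
Proof.
split.
  rewrite inE; apply: (@le_lt_trans _ _ 0%E); last exact: ltry.
  rewrite /sqsum esum1// => n _.
  by rewrite [normc _]normc0 expr0n.
move=> c f g fl gl.
have : (c *: f)%R \in square_summable.
  apply: (square_summable_le (sqr_ge0 (normc c)) _ fl) => n.
  by rewrite [_ n]/(c * f n) normcM exprMn.
move: gl; rewrite !inE => gl fl'; apply: (le_lt_trans (sqsumD_le _ _ ltr01)).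
by rewrite lte_add_pinfty// lte_mul_pinfty ?lee_fin ?addr_ge0 ?invr_ge0//.
Qed.

HB.instance Definition _ :=
  GRing.isSubmodClosed.Build _ _ square_summable square_summable_submod.

End SquareSum.

Record l2Z (R : realType) := L2Z {
  l2val :> int -> R[i];
  l2valP : l2val \in square_summable }.

Section L2Z.
Variable R : realType.

HB.instance Definition _ := [isSub for @l2val R].
HB.instance Definition _ := [Choice of l2Z R by <:].
HB.instance Definition _ := [SubChoice_isSubLmodule of l2Z R by <:].

Implicit Types u v : l2Z R.

Lemma sqsum_fin u : sqsum u \is a fin_num.
Proof. by rewrite ge0_fin_numE ?sqsum_ge0//; have := l2valP u; rewrite inE. Qed.

Definition l2norm u : R := Num.sqrt (fine (sqsum u)).

Lemma l2norm_ge0 u : 0 <= l2norm u. Proof. exact: sqrtr_ge0. Qed.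

Lemma l2norm_sq u : (l2norm u ^+ 2)%:E = sqsum u.
Proof. by rewrite sqr_sqrtr ?fine_ge0 ?sqsum_ge0// fineK ?sqsum_fin. Qed.

Lemma l2norm_eq0 u : l2norm u = 0 -> u = 0.
Proof.
move=> u0; apply: val_inj; apply/funext => n /=; apply: eq0_normc.
apply/eqP; rewrite -sqrf_eq0 eq_le sqr_ge0 andbT -lee_fin.
apply: (@le_trans _ _ (sqsum u)); last by rewrite -l2norm_sq u0 expr0n.
apply: esum_ge; exists [set n]; first by split => //; exact: finite_set1.
by rewrite fsbig_set1.
Qed.

Lemma l2norm_triangle u v : l2norm (u + v) <= l2norm u + l2norm v.
Proof.
have [/l2norm_eq0 ->|u0] := eqVneq (l2norm u) 0.
  by rewrite add0r lerDr l2norm_ge0.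
have [/l2norm_eq0 ->|v0] := eqVneq (l2norm v) 0.
  by rewrite addr0 lerDl l2norm_ge0.
have {}u0 : 0 < l2norm u by rewrite lt_neqAle eq_sym u0 l2norm_ge0.
have {}v0 : 0 < l2norm v by rewrite lt_neqAle eq_sym v0 l2norm_ge0.
rewrite -ler_sqr ?nnegrE ?addr_ge0 ?l2norm_ge0// -lee_fin l2norm_sq.
apply: (le_trans (sqsumD_le _ _ (divr_gt0 v0 u0))).
rewrite -!l2norm_sq -!EFinM -EFinD lee_fin le_eqVlt; apply/orP; left; apply/eqP.
by field; rewrite !gt_eqF.
Qed.

Lemma l2normZ_le (c : R[i]) u : l2norm (c *: u) <= normc c * l2norm u.
Proof.
rewrite -ler_sqr ?nnegrE ?mulr_ge0 ?l2norm_ge0 ?normc_pos//.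
rewrite exprMn -lee_fin [leRHS]EFinM !l2norm_sq sqsum_le ?sqr_ge0// => n.
by rewrite [_ n]/(c * u n) normcM exprMn.
Qed.

Lemma l2normZ (c : R[i]) u : l2norm (c *: u) = normc c * l2norm u.
Proof.
have [->|c0] := eqVneq c 0.
  by apply/eqP; rewrite eq_le l2normZ_le normc0 mul0r l2norm_ge0.
have nc0 : 0 < normc c.
  rewrite lt_neqAle normc_pos andbT eq_sym.
  by apply: contra c0 => /eqP/eq0_normc ->.
apply/eqP; rewrite eq_le l2normZ_le/=.
rewrite -ler_pdivlMl// -normcV.
apply: (le_trans _ (l2normZ_le c^-1 (c *: u))); by rewrite scalerA mulVf// scale1r.
Qed.

Lemma l2normC_triangle u v :
  (l2norm (u + v))%:C <= (l2norm u)%:C + (l2norm v)%:C.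
Proof. by rewrite -rmorphD lecR l2norm_triangle. Qed.

Lemma l2normCZ (c : R[i]) u : (l2norm (c *: u))%:C = `|c| * (l2norm u)%:C.
Proof. by rewrite l2normZ rmorphM. Qed.

Lemma l2normC_eq0 u : (l2norm u)%:C = 0 -> u = 0.
Proof. by move=> /complexI/l2norm_eq0. Qed.

(* A normed module over K := R[i] has a K-valued norm, whence the injection. *)
HB.instance Definition _ := Lmodule_isNormed.Build R[i] (l2Z R)
  l2normC_triangle l2normCZ l2normC_eq0.

End L2Z.

(* Bounded linear maps are the continuous ones ([linear_bounded_continuous]);
   z is in the resolvent set iff T - z has a bounded two-sided inverse. *)
Definition resolvent_set (K : numFieldType) (V : normedModType K)
    (T : {linear V -> V}) : set K :=
  [set z | exists B : {linear V -> V},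
    [/\ continuous B, cancel (fun u => T u - z *: u) B
      & cancel B (fun u => T u - z *: u)]].

Definition spectrum (K : numFieldType) (V : normedModType K)
    (T : {linear V -> V}) : set K := ~` resolvent_set T.

Section AlmostMathieu.
Variable R : realType.
Implicit Types (alpha theta : R) (u : l2Z R).

Definition amo_fun alpha theta (f : int -> R[i]) : int -> R[i] := fun n =>
  f (n - 1) + f (n + 1) +
  (2 * cos (2 * pi * (alpha * n%:~R + theta)))%:C * f n.

Lemma amo_fun_l2 alpha theta u : amo_fun alpha theta u \in square_summable.
Proof.
have -> : amo_fun alpha theta u = (fun n => u (n - 1)) + (fun n => u (n + 1)) +
  (fun n => (2 * cos (2 * pi * (alpha * n%:~R + theta)))%:C * u n) by [].
rewrite !rpredD ?square_summable_shift ?l2valP//.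
apply: (@square_summable_le _ 4 u) => // [n|]; last exact: l2valP.
rewrite normc_realM exprMn ler_wpM2r ?sqr_ge0// real_normK ?num_real// exprMn.
have := cos2Dsin2 (2 * pi * (alpha * n%:~R + theta)).
set c := cos _; set s := sin _ => cs; have := sqr_ge0 s; nra.
Qed.

Definition amo alpha theta u : l2Z R := L2Z (amo_fun_l2 alpha theta u).

Lemma amo_is_linear alpha theta : linear (amo alpha theta).
Proof.
move=> c u v; apply: val_inj; apply/funext => n.
change (amo_fun alpha theta (fun m => c * u m + v m) n =
        c * amo_fun alpha theta u n + amo_fun alpha theta v n).
by rewrite /amo_fun; ring.
Qed.
HB.instance Definition _ alpha theta :=
  GRing.isLinear.Build _ _ _ _ _ (amo_is_linear alpha theta).

(* The operators are self-adjoint, so their spectra lie on the real axis of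
   R[i]; the union is taken as a set of real numbers in order to be measured. *)
Definition amo_spectrum alpha : set R :=
  \bigcup_(theta in `[0, 1[) [set E | spectrum (amo alpha theta) E%:C].

End AlmostMathieu.

(* Main.v *)
Require Import Defs.
From HB Require Import structures.
From mathcomp Require Import all_boot all_order all_algebra.
From mathcomp Require Import complex.
From mathcomp Require Import all_classical all_reals all_analysis.
From mathcomp Require Import ring lra zify.

(** Let alpha = p/q and omega = exp(2 i pi alpha).  If the trace t of the
    transfer matrix of H_theta over a period satisfies |t| > 2, then E is in the
    resolvent set, because t(H) = S^q + S^-q for the shift S.  Otherwise Hu = Eu
    has a Bloch solution u_(n+q) = x u_n with |x| = 1.  Diagonalizing U V^-1
    instead of V = omega^n exp(2 i pi theta), where U is the shift, turns it by
    a finite Fourier transform into a Bloch solution of the chiral operator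
      E psi_n = b_n psi_(n+1) + (b_(n-1))^* psi_(n-1),  b_n = 1 + mu omega^-n.
    The trace of the chiral transfer matrix over a period does not depend on mu,
    and it is at most 4 in absolute value as prod_n b_n = 1 - (-mu)^q.  Hence
    every E of the spectrum has a chiral Bloch solution for the single value
    mu0 = - exp(i pi/q), for which this bound is 4, so that E is an eigenvalue
    of a cyclic Jacobi matrix, in which the Bloch multiplier only affects the
    corner entry, of modulus |b_0|.  Such matrices all lie between A - |b_0| D
    and A + |b_0| D, where A is the matrix without the corner and D has trace 2,
    so E lies between the i-th eigenvalues of these two bounds for some i.  The
    total length of these intervals is 4 |b_0| = 4 |1 - exp(i pi/q)| <= 4 pi/q. *)

Set Implicit Arguments.
Unset Strict Implicit.
Unset Printing Implicit Defensive.

Import Order.TTheory GRing.Theory Num.Theory.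

Local Open Scope ring_scope.

(** * Transfer matrices and Bloch solutions *)

Section TransferMatrices.
Variable R : comNzRingType.
Implicit Types (A B : 'M[R]_2) (T : nat -> 'M[R]_2) (a b c d : R).

Definition mx2 a b c d : 'M[R]_2 :=
  \matrix_(i, j) if i == 0 then if j == 0 then a else b
                 else if j == 0 then c else d.

Lemma mx2E A : A = mx2 (A 0 0) (A 0 1) (A 1 0) (A 1 1).
Proof.
by apply/matrixP => [[[|[|?]] ?] [[|[|?]] ?]] //; rewrite mxE/=;
  congr (A _ _); apply: val_inj.
Qed.

Lemma mulmx2 a b c d a' b' c' d' : mx2 a b c d *m mx2 a' b' c' d' =
  mx2 (a * a' + b * c') (a * b' + b * d') (c * a' + d * c') (c * b' + d * d').
Proof.
by apply/matrixP => [[[|[|?]] ?] [[|[|?]] ?]] //;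
  rewrite !mxE/= big_ord_recl big_ord1 !mxE.
Qed.

Lemma trace_mx2 a b c d : \tr (mx2 a b c d) = a + d.
Proof. by rewrite /mxtrace big_ord_recl big_ord1 !mxE. Qed.

Lemma det_mx2 a b c d : \det (mx2 a b c d) = a * d - b * c.
Proof.
rewrite (expand_det_row _ 0) big_ord_recl big_ord1 !mxE/= /cofactor.
by rewrite !det_mx11 !mxE/= expr0 expr1 mul1r mulN1r mulrN.
Qed.

Lemma mx2_Cayley_Hamilton A : A *m A = \tr A *: A - (\det A)%:M.
Proof.
rewrite (mx2E A) mulmx2 trace_mx2 det_mx2; move: (A 0 0) (A 0 1) (A 1 0) (A 1 1).
move=> a b c d.
by apply/matrixP => [[[|[|?]] ?] [[|[|?]] ?]] //; rewrite !mxE/= ?mulr0n ?mulr1n; ring.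
Qed.

Fixpoint transfer T k : 'M[R]_2 :=
  if k is k'.+1 then T k' *m transfer T k' else 1%:M.

Lemma transferS T k : transfer T k.+1 = T k *m transfer T k.
Proof. by []. Qed.

Lemma eq_transfer T T' k :
  (forall i, (i < k)%N -> T i = T' i) -> transfer T k = transfer T' k.
Proof.
elim: k => //= k IH TT; rewrite TT// IH// => i ik; exact/TT/ltnW.
Qed.

Lemma transferSr T k : transfer T k.+1 = transfer (fun i => T i.+1) k *m T 0%N.
Proof.
elim: k => [|k IH]; first by rewrite /= mulmx1 mul1mx.
by rewrite [LHS]/= -/(transfer T k.+1) IH mulmxA.
Qed.

Lemma det_transfer T k : \det (transfer T k) = \prod_(i < k) \det (T i).
Proof.
elim: k => [|k IH] /=; first by rewrite det1 big_ord0.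
by rewrite det_mulmx IH big_ord_recr/= mulrC.
Qed.

(** Moving the window by one step takes the factor [T 0] from one end of the product to the other,
    and the trace is cyclic. *)
Lemma trace_transfer_shift T q : T q = T 0%N ->
  \tr (transfer (fun i => T i.+1) q) = \tr (transfer T q).
Proof.
case: q => [//|k] Tq.
by rewrite [transfer _ k.+1]/= Tq mxtrace_mulC -transferSr.
Qed.

End TransferMatrices.

Lemma map_transfer (R S : comNzRingType) (f : {rmorphism R -> S})
    (T : nat -> 'M[R]_2) k :
  map_mx f (transfer T k) = transfer (fun i => map_mx f (T i)) k.
Proof. by elim: k => [|k IH] /=; rewrite ?map_mx1// map_mxM IH. Qed.

Lemma map_mx2 (R S : comNzRingType) (f : R -> S) a b c d :
  map_mx f (mx2 a b c d) = mx2 (f a) (f b) (f c) (f d).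
Proof.
by apply/matrixP => [[[|[|?]] ?] [[|[|?]] ?]] //; rewrite !mxE.
Qed.

(** * Eigenvectors of the monodromy and quasi-periodic solutions *)

Section Floquet.
Variable F : fieldType.
Implicit Types (A : 'M[F]_2) (T : nat -> 'M[F]_2) (x : F).

Lemma mx2_eigenvector A x : x ^+ 2 - \tr A * x + \det A = 0 ->
  exists2 w : 'cV_2, w != 0 & A *m w = x *: w.
Proof.
move=> char.
have /eqP/det0P[w w0 wA] : \det (A - x%:M)^T = 0.
  rewrite det_tr (mx2E A) (_ : _ - x%:M =
    mx2 (A 0 0 - x) (A 0 1) (A 1 0) (A 1 1 - x)).
    rewrite det_mx2 -[RHS]char (mx2E A) trace_mx2 det_mx2 !mxE/=; ring.
  apply/matrixP => [[[|[|?]] ?] [[|[|?]] ?]] //; rewrite !mxE/= ?mulr1n ?mulr0n ?subr0//.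
exists w^T; first by rewrite -trmx0 (inj_eq (@trmx_inj _ _ _)).
move/(congr1 trmx): wA; rewrite trmx_mul trmxK trmx0 mulmxBl mul_scalar_mx.
by move/eqP; rewrite subr_eq0 => /eqP.
Qed.

Lemma mx2_char_root A x (w : 'cV_2) : w != 0 -> A *m w = x *: w ->
  x ^+ 2 - \tr A * x + \det A = 0.
Proof.
move=> w0 Aw; apply/eqP; apply: contraNT w0 => c0.
have : (x ^+ 2 - \tr A * x + \det A) *: w == 0.
  have : A *m A *m w = x ^+ 2 *: w by rewrite -mulmxA Aw -scalemxAr Aw scalerA.
  rewrite mx2_Cayley_Hamilton mulmxBl -scalemxAl Aw mul_scalar_mx scalerA.
  by rewrite scalerDl scalerBl => <-; rewrite addrAC subrK subrr.
by move=> /eqP cw; rewrite -(scale1r w) -(mulVf c0) -scalerA cw scaler0.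
Qed.

Lemma transferD T k l :
  transfer T (k + l) = transfer (fun i => T (i + l)%N) k *m transfer T l.
Proof. by elim: k => [|k IH]; rewrite ?mul1mx// addSn /= IH mulmxA. Qed.

Lemma transfer_eigen_periodic T q x (w : 'cV_2) :
  (forall i, T (i + q)%N = T i) -> transfer T q *m w = x *: w ->
  forall k, transfer T (k + q) *m w = x *: (transfer T k *m w).
Proof.
move=> Tq Tw k; rewrite transferD -mulmxA Tw -scalemxAr.
by congr (_ *: (_ *m _)); apply: eq_transfer => i _.
Qed.

End Floquet.

(** Evaluate X^q - 1 = prod_j (X - om^j) at -1/z and multiply by (-z)^q. *)
Lemma prod_unity_roots (F : fieldType) q (om z : F) : q.-primitive_root om -> z != 0 ->
  \prod_(j < q) (1 + z * om ^+ j) = 1 - (- z) ^+ q.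
Proof.
move=> om_prim z0; have := congr1 (fun p => (- z) ^+ q * p.[- z^-1]) (factor_Xn_sub_1 om_prim).
rewrite big_mkord horner_prod -[X in _ ^+ X * _](card_ord q) -prodr_const -big_split/=.
rewrite !hornerE mulrBr mulr1 -exprMn mulrNN divff// expr1n => <-.
by apply: eq_bigr => j _; rewrite !hornerE mulrDr mulrNN divff// mulrNN.
Qed.

Section RootsOfUnity.
Variable F : numFieldType.
Variables (q : nat) (om : F).
Hypothesis q0 : (0 < q)%N.
Hypothesis om_prim : q.-primitive_root om.

Lemma sum_expr_unity_root (z : F) : z ^+ q = 1 -> z != 1 ->
  \sum_(j < q) z ^+ j = 0.
Proof.
move=> zq z1; have := subrX1 z q; rewrite zq subrr => /esym/eqP.
by rewrite mulf_eq0 subr_eq0 (negPf z1) => /eqP.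
Qed.

Lemma sum_periodic (h : nat -> F) : h q = h 0%N ->
  \sum_(m < q) h m.+1 = \sum_(m < q) h m.
Proof.
case: q => [|k] hk; first by rewrite !big_ord0.
by rewrite big_ord_recr [RHS]big_ord_recl hk addrC.
Qed.

Lemma prim_neq0 : om != 0.
Proof.
apply/eqP => om0; have := prim_expr_order om_prim.
by rewrite om0 expr0n gtn_eqF// => /eqP; rewrite eq_sym oner_eq0.
Qed.

Lemma prim_exprDq i : om ^+ (i + q) = om ^+ i.
Proof. by rewrite exprD (prim_expr_order om_prim) mulr1. Qed.

Lemma primV : q.-primitive_root om^-1.
Proof.
apply/andP; split=> //; apply/forallP => i; rewrite unity_rootE exprVn invr_eq1.
by rewrite -(prim_order_dvd om_prim); have /andP[_ /forallP/(_ i)] := om_prim;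
  rewrite unity_rootE -(prim_order_dvd om_prim).
Qed.

(** * Chiral transfer matrices and the independence of their trace from mu *)

Section Chiral.
Variable E : F.
Implicit Types (mu : F) (n : nat).

(** For |mu| = |om| = 1, [chi_c] is the complex conjugate of [chi_b]; written without conjugation it
    keeps the trace a Laurent polynomial in mu. *)
Definition chi_b mu n := 1 + mu / om ^+ n.
Definition chi_c mu n := 1 + om ^+ n / mu.
(** It sends (psi_(n+1), psi_n) to b_(n+1) (psi_(n+2), psi_(n+1)): the recursion is not divided by
    b_(n+1), which may vanish. *)
Definition chi_step mu n : 'M[F]_2 := mx2 E (- chi_c mu n) (chi_b mu n.+1) 0.
Definition chi_trace mu := \tr (transfer (chi_step mu) q).

Lemma chi_bDq mu n : chi_b mu (n + q) = chi_b mu n.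
Proof. by rewrite /chi_b prim_exprDq. Qed.

Lemma chi_stepDq mu n : chi_step mu (n + q) = chi_step mu n.
Proof. by rewrite /chi_step -addSn chi_bDq /chi_c prim_exprDq. Qed.

Lemma prod_chi_bS mu : \prod_(n < q) chi_b mu n.+1 = \prod_(n < q) chi_b mu n.
Proof.
case: q (chi_bDq mu 0) => [|k] hk; first by rewrite !big_ord0.
by rewrite big_ord_recr [RHS]big_ord_recl/= mulrC hk.
Qed.

Lemma prod_chi_b mu : mu != 0 -> \prod_(n < q) chi_b mu n = 1 - (- mu) ^+ q.
Proof.
move=> mu0; rewrite -(prod_unity_roots primV mu0); apply: eq_bigr => j _.
by rewrite /chi_b exprVn.
Qed.

Lemma prod_chi_c mu : mu != 0 -> \prod_(n < q) chi_c mu n = 1 - (- mu^-1) ^+ q.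
Proof.
move=> mu0; rewrite -(prod_unity_roots om_prim) ?invr_eq0//; apply: eq_bigr => j _.
by rewrite /chi_c mulrC.
Qed.

Lemma det_chi_transfer mu :
  \det (transfer (chi_step mu) q) =
  (\prod_(n < q) chi_b mu n.+1) * \prod_(n < q) chi_c mu n.
Proof.
rewrite det_transfer -big_split/=; apply: eq_bigr => n _.
by rewrite det_mx2; ring.
Qed.

(** Replacing mu by om mu shifts the index of b and c by one, and the trace over a period is blind
    to such a shift. *)
Lemma chi_trace_rotate mu : mu != 0 -> chi_trace (om * mu) = chi_trace mu.
Proof.
move=> mu0; rewrite /chi_trace -trace_transfer_shift ?(chi_stepDq _ 0)//.
congr mxtrace; apply: eq_transfer => n _; have om0 := prim_neq0.
have on0 : om ^+ n != 0 by rewrite expf_neq0.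
rewrite /chi_step /chi_b /chi_c !exprS.
by congr mx2; field; rewrite ?mu0 ?om0 ?on0.
Qed.

(* mu times the transfer matrix is polynomial in mu, with the entries of the
   product of q such matrices of degree at most 2q and with the diagonal ones
   divisible by mu and of degree less than 2q. *)
Definition chi_poly_step n : 'M[{poly F}]_2 :=
  mx2 (E *: 'X) (- ('X + (om ^+ n)%:P)) ('X + om ^- n.+1 *: 'X^2) 0.

Lemma horner_chi_poly_step mu n : mu != 0 ->
  map_mx (horner_eval mu) (chi_poly_step n) = mu *: chi_step mu n.
Proof.
move=> mu0; rewrite map_mx2 /horner_eval !hornerE /chi_step.
apply/matrixP => [[[|[|?]] ?] [[|[|?]] ?]] //; rewrite !mxE/= ?mulr0//.
- by rewrite mulrC.
- by rewrite /chi_c; field.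
- by rewrite /chi_b; ring.
Qed.

Lemma horner_chi_poly_trace mu : mu != 0 ->
  (\tr (transfer chi_poly_step q)).[mu] = mu ^+ q * chi_trace mu.
Proof.
move=> mu0; rewrite -[LHS]/(horner_eval mu _) -trace_map_mx map_transfer.
rewrite /chi_trace -mxtraceZ; congr mxtrace.
rewrite (@eq_transfer _ _ (fun n => mu *: chi_step mu n)); last first.
  by move=> i _; exact: horner_chi_poly_step.
elim: q => [|k IH] /=; first by rewrite expr0 scale1r.
by rewrite IH -scalemxAl -scalemxAr scalerA -exprS.
Qed.

(** Induction on the number of factors. The entry (1,0) may have one degree more, from the quadratic
    entry of the last factor; its zero constant term is what keeps (0,0) divisible by mu. *)
Lemma chi_poly_transfer_bounds k P : P = transfer chi_poly_step k.+1 ->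
  [/\ (size (P 0 0)%R <= k.*2.+2)%N, (size (P 0 1)%R <= k.*2.+2)%N,
      (size (P 1 0)%R <= k.*2.+3)%N & (size (P 1 1)%R <= k.*2.+2)%N] /\
  [/\ (P 0 0)`_0 = 0, (P 1 0)`_0 = 0 & (P 1 1)`_0 = 0].
Proof.
have sX2 n : (size ('X + om ^- n.+1 *: 'X^2)%R <= 3)%N.
  rewrite (leq_trans (size_polyD _ _))// geq_max size_polyX.
  by rewrite (leq_trans (size_scale_leq _ _))// size_polyXn.
have sX1 n : (size (- ('X + (om ^+ n)%:P))%R <= 2)%N.
  by rewrite size_polyN size_XaddC.
have sEX : (size (E *: 'X)%R <= 2)%N.
  by rewrite (leq_trans (size_scale_leq _ _))// size_polyX.
have sM (p r : {poly F}) a b c : (size p <= a)%N -> (size r <= b)%N ->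
    (a + b <= c.+1)%N -> (size (p * r)%R <= c)%N.
  move=> pa rb abc; apply: leq_trans (size_polyMleq _ _) _.
  by have := leq_add pa rb; lia.
have sD (p r : {poly F}) c : (size p <= c)%N -> (size r <= c)%N ->
    (size (p + r)%R <= c)%N.
  by move=> pc rc; rewrite (leq_trans (size_polyD _ _))// geq_max pc.
elim: k P => [|k IH] P ->.
  rewrite /= mulmx1 !mxE/=; split; split=> //; rewrite ?size_poly0//.
  - by rewrite coefZ coefX mulr0.
  - by rewrite coefD coefX coefZ coefXn mulr0 addr0.
  - by rewrite coef0.
rewrite transferS; move: (transfer _ k.+1) (IH _ erefl).
move=> Q [[b00 b01 b10 b11] [v00 v10 v11]].
rewrite (mx2E Q) mulmx2 !mxE/= !mul0r !addr0; split; split.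
- by apply: sD; [apply: (sM _ _ _ _ _ sEX b00); lia|apply: (sM _ _ _ _ _ (sX1 _) b10); lia].
- by apply: sD; [apply: (sM _ _ _ _ _ sEX b01); lia|apply: (sM _ _ _ _ _ (sX1 _) b11); lia].
- by apply: (sM _ _ _ _ _ (sX2 _) b00); lia.
- by apply: (sM _ _ _ _ _ (sX2 _) b01); lia.
- by rewrite coefD !coef0M v00 v10 !mulr0 addr0.
- by rewrite coef0M v00 mulr0.
- by rewrite coef0M coefD coefX coefZ coefXn mulr0 addr0 mul0r.
Qed.

(** The polynomial p(mu), equal to mu^q times the trace, is invariant under mu -> om mu. Averaging
    it over these rotations thus leaves it unchanged, and kills the monomials whose degree is not a
    multiple of q. As p has degree below 2q and no constant term, only degree q survives. *)
Lemma chi_trace_const : exists D, forall mu, mu != 0 -> chi_trace mu = D.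
Proof.
set p := \tr (transfer chi_poly_step q).
have [psize p0] : (size p <= q.*2)%N /\ p`_0 = 0.
  rewrite /p; case: q q0 => // k _.
  have [[b00 _ _ b11] [v00 _ v11]] := chi_poly_transfer_bounds (erefl (transfer chi_poly_step k.+1)).
  rewrite (mx2E (transfer _ _)) trace_mx2; split.
    by rewrite (leq_trans (size_polyD _ _))// geq_max b00.
  by rewrite coefD v00 v11 addr0.
exists p`_q => mu mu0.
have rotE j : p.[om ^+ j * mu] = p.[mu].
  elim: j => [|j IH]; first by rewrite mul1r.
  have omj : om ^+ j * mu != 0 by rewrite mulf_neq0 ?expf_neq0 ?prim_neq0.
  rewrite exprS -mulrA horner_chi_poly_trace ?mulf_neq0 ?expf_neq0 ?prim_neq0//.
  rewrite chi_trace_rotate// exprMn (prim_expr_order om_prim) mul1r.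
  by rewrite -horner_chi_poly_trace ?IH.
have : \sum_(j < q) p.[om ^+ j * mu] = q%:R * p.[mu].
  under eq_bigr do rewrite rotE.
  by rewrite sumr_const card_ord mulr_natl.
have -> : \sum_(j < q) p.[om ^+ j * mu] = q%:R * (p`_q * mu ^+ q).
  rewrite (eq_bigr (fun j : 'I_q => \sum_(i < q.*2) p`_i * mu ^+ i * (om ^+ i) ^+ j)); last first.
    move=> j _; rewrite (horner_coef_wide _ psize); apply: eq_bigr => i _.
    by rewrite exprMn -!exprM mulnC; ring.
  rewrite exchange_big/=.
  have qq : (q < q.*2)%N by lia.
  rewrite (bigD1 (Ordinal qq))//= [X in _ + X]big1 ?addr0.
    rewrite (prim_expr_order om_prim) -mulr_sumr mulrC; congr (_ * _).
    by rewrite (eq_bigr (fun=> 1)) ?sumr_const ?card_ord// => j _; rewrite expr1n.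
  move=> i iq; rewrite -mulr_sumr.
  have [i0|i0] := eqVneq (i : nat) 0%N; first by rewrite i0 p0 !mul0r.
  rewrite sum_expr_unity_root ?mulr0//.
    by rewrite -exprM mulnC exprM (prim_expr_order om_prim) expr1n.
  rewrite -(prim_order_dvd om_prim); apply: contra iq => /dvdnP[k ik].
  rewrite -val_eqE /= ik; have := ltn_ord i; rewrite ik -muln2 mulnC ltn_pmul2l//.
  case: k ik => [|[|k]] ik; first by rewrite ik in i0.
    by rewrite muln1 eqxx.
  by rewrite ltnS ltnS ltn0.
have q0F : q%:R != 0 :> F by rewrite pnatr_eq0 -lt0n.
move=> /(mulfI q0F); rewrite horner_chi_poly_trace// mulrC.
by move=> /(mulfI (expf_neq0 _ mu0)).
Qed.

End Chiral.

End RootsOfUnity.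

(** * Duality with the chiral operator, and its Bloch solutions *)

Section ChiralBloch.
Variable F : numFieldType.
Variables (q : nat) (om E : F).
Hypothesis q0 : (0 < q)%N.
Hypothesis om_prim : q.-primitive_root om.

Let om0 : om != 0 := prim_neq0 q0 om_prim.
Let omk0 k : om ^+ k != 0. Proof. by rewrite expf_neq0. Qed.

Definition chiral_bloch (mu y : F) (psi : nat -> F) : Prop :=
  [/\ forall n, E * psi n.+1 =
        chi_b om mu n.+1 * psi n.+2 + chi_c om mu n * psi n,
      forall n, psi (n + q)%N = y * psi n & exists n, psi n != 0].

Lemma quasi_periodic_neq0 (u : nat -> F) x :
  (forall m, u (m + q)%N = x * u m) -> (exists m, u m != 0) ->
  exists2 m, (m < q)%N & u m != 0.
Proof.
move=> ux [m um]; exists (m %% q)%N; first by rewrite ltn_mod.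
apply: contra um => /eqP um; rewrite (divn_eq m q).
elim: (m %/ q)%N => [|k IH]; first by rewrite mul0n add0n um.
by rewrite mulSn -addnA addnC ux (eqP IH) mulr0.
Qed.

Section Duality.
Variables (V0 x mu : F) (u : nat -> F).
Hypothesis V00 : V0 != 0.
Hypothesis mu0 : mu != 0.
Let V m := V0 * om ^+ m.
Hypothesis uE : forall m,
  E * u m.+1 = u m.+2 + u m + (V m.+1 + (V m.+1)^-1) * u m.+1.
Hypothesis ux : forall m, u (m + q)%N = x * u m.
Hypothesis u0 : exists m, u m != 0.
Hypothesis muV : mu ^+ q * \prod_(j < q) V j.+1 = x.

Let V_neq0 m : V m != 0. Proof. by rewrite mulf_neq0. Qed.

Let x0 : x != 0.
Proof.
by rewrite -muV mulf_neq0 ?expf_neq0//; apply/prodf_neq0 => i _.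
Qed.

(** Gauge factor absorbing mu V_(m+1) at each shift; [muV] is the condition under which [g m * u m]
    has period q. *)
Let g m := \prod_(j < m) (mu * V j.+1)^-1.

Let gS m : g m = mu * V m.+1 * g m.+1.
Proof. by rewrite /g big_ord_recr/= mulrCA divff ?mulr1// mulf_neq0. Qed.

Let g_neq0 m : g m != 0.
Proof. by apply/prodf_neq0 => j _; rewrite invr_eq0 mulf_neq0. Qed.

Let VDq m : V (m + q) = V m. Proof. by rewrite /V (prim_exprDq om_prim). Qed.

Let gDq m : g (m + q) * x = g m.
Proof.
elim: m => [|m IH].
  rewrite add0n /g big_ord0 -muV -[X in mu ^+ X](card_ord q) -prodr_const.
  by rewrite -big_split prodfV mulVf//; apply/prodf_neq0 => j _; rewrite mulf_neq0.
apply: (mulfI (mulf_neq0 mu0 (V_neq0 m.+1))).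
by rewrite -(gS m) -IH (gS (m + q)) -addSn VDq mulrA.
Qed.

Let h n m := g m * V m ^+ n * u m.

Let hDq n : h n q = h n 0%N.
Proof.
by rewrite /h -(add0n q) ux VDq -(gDq 0); ring.
Qed.

(** The finite Fourier transform psi_n = sum_m g_m V_m^n u_m over one period. Multiplying u by V or
    V^-1 shifts n by one, which yields the terms 1 of b and c; a shift of m, absorbed by [gS] and
    V_(m+1) = om V_m, yields the terms with mu. *)
Lemma landau_to_chiral : exists psi, chiral_bloch mu (V0 ^+ q) psi.
Proof.
pose psi n := \sum_(m < q) h n m; exists psi.
have hDq1 n : h n q.+1 = h n 1%N.
  by rewrite /h -[q.+1]add1n ux VDq -(gDq 1); ring.
(* The summand is periodic in m, so the window of summation can be moved to align u_m, u_(m+1) and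
   u_(m+2). *)
have psiS n : psi n = \sum_(m < q) h n m.+1 by rewrite sum_periodic.
have psiSS n : psi n = \sum_(m < q) h n m.+2.
  by rewrite (@sum_periodic F q (fun m => h n m.+1)).
split.
- move=> n; rewrite [psi n.+1]psiS mulr_sumr.
  rewrite /chi_b /chi_c !mulrDl !mul1r {1}[psi n.+2]psiS {1}[psi n]psiS.
  rewrite [psi n.+2]psiSS /psi !mulr_sumr -!big_split/=; apply: eq_bigr => m _.
  rewrite /h [E * _]mulrCA uE; rewrite (gS m) (gS m.+1).
  have -> : V m.+2 = om * V m.+1 by rewrite /V !exprS; ring.
  have -> : V m.+1 = om * V m by rewrite /V !exprS; ring.
  rewrite !exprS !exprMn.
  have o1 := omk0 n. have V1 := V_neq0 m.
  by field; rewrite mu0 o1 om0 V1.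
- move=> n; rewrite /psi mulr_sumr; apply: eq_bigr => m _.
  rewrite /h exprD [V m ^+ q]exprMn -exprM mulnC exprM (prim_expr_order om_prim).
  by rewrite expr1n; ring.
have [j jq uj] := quasi_periodic_neq0 ux u0.
have [/existsP[n psin]|/existsPn psi0] :=
  boolP [exists n : 'I_q, psi n != 0]; first by exists n.
(* Inverting the Fourier transform at a site j with u_j nonzero recovers q g_j u_j from the psi_n,
   which therefore cannot all vanish. *)
have : \sum_(n < q) (V j)^-1 ^+ n * psi n = q%:R * (g j * u j).
  under eq_bigr do rewrite mulr_sumr.
  rewrite exchange_big/= (bigD1 (Ordinal jq))//= [X in _ + X]big1 ?addr0.
    under eq_bigr => n _.
      rewrite (_ : _ * _ = g j * u j); last first.
        by rewrite /h exprVn /=; field; rewrite expf_neq0.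
      over.
    by rewrite sumr_const card_ord mulr_natl.
  move=> m mj.
  under eq_bigr => n _.
    rewrite (_ : _ * _ = g m * u m * (V m / V j) ^+ n); last first.
      by rewrite /h [(V m / V j) ^+ n]exprMn; ring.
    over.
  rewrite -mulr_sumr.
  have VV : V m / V j = om ^+ m / om ^+ j.
    by rewrite /V; field; rewrite ?om0 ?omk0 ?V00.
  rewrite sum_expr_unity_root ?mulr0// VV.
    by rewrite exprMn exprVn -!exprM ![(_ * q)%N]mulnC !exprM
      (prim_expr_order om_prim) !expr1n divr1.
  apply: contra mj => /eqP/(congr1 (fun z => z * om ^+ j)).
  rewrite divfK// mul1r => /eqP; rewrite (eq_prim_root_expr om_prim).
  by rewrite /eqn !modn_small.
rewrite big1 => [|n _]; last by have /negPn/eqP -> := psi0 n; rewrite mulr0.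
move/esym/eqP; rewrite !mulf_eq0 pnatr_eq0 -leqn0 leqNgt q0/=.
by rewrite (negPf (g_neq0 j)) (negPf uj).
Qed.
End Duality.

Let state (psi : nat -> F) k : 'cV[F]_2 :=
  \col_i (if i == 0 then psi k.+1 else psi k).

Let mul_mx2_state a b c d psi k : mx2 a b c d *m state psi k =
  \col_i (if i == 0 then a * psi k.+1 + b * psi k
          else c * psi k.+1 + d * psi k).
Proof.
apply/matrixP => [[[|[|?]] ?] j] //;
  by rewrite !mxE big_ord_recl big_ord1 !mxE.
Qed.

Let chi_transfer_state mu y psi k : chiral_bloch mu y psi ->
  transfer (chi_step om E mu) k *m state psi 0%N =
  (\prod_(n < k) chi_b om mu n.+1) *: state psi k.
Proof.
move=> [psiE _ _]; elim: k => [|k IH]; first by rewrite mul1mx big_ord0 scale1r.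
rewrite transferS -mulmxA IH -scalemxAr big_ord_recr/= -scalerA; congr (_ *: _).
rewrite mul_mx2_state; apply/matrixP => i j; rewrite !mxE; case: eqP => _.
  by rewrite psiE mulNr addrK.
by rewrite mul0r addr0.
Qed.

Let stateq mu y psi : chiral_bloch mu y psi -> state psi q = y *: state psi 0%N.
Proof.
move=> [_ psiq _]; apply/matrixP => i j; rewrite !mxE.
by case: eqP => _; rewrite -?(psiq 0%N) -?(psiq 1%N) ?add1n.
Qed.

(** From psi_1 = 0 and c_0 psi_0 = 0 the recursion carries zeros along to psi_q, since the b_n met
    on the way are nonzero; then y psi_0 = psi_q = 0 and psi vanishes on a whole period. *)
Let bloch1_neq0 mu y psi : y != 0 -> chiral_bloch mu y psi ->
  (forall n, (0 < n < q)%N -> chi_b om mu n != 0) ->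
  psi 0%N = 0 \/ chi_c om mu 0%N = 0 -> psi 1%N != 0.
Proof.
move=> y0 [psiE psiq psi0] b0 z0; apply/eqP => psi1.
have zero k : (k < q)%N -> psi k.+1 = 0 /\ chi_c om mu k * psi k = 0.
  elim: k => [_|k IH kq].
    by split=> //; case: z0 => ->; rewrite ?mulr0 ?mul0r.
  have [p1 p0] := IH (ltnW kq).
  split; last by rewrite p1 mulr0.
  have /esym/eqP := psiE k; rewrite p1 p0 mulr0 addr0 mulf_eq0.
  by rewrite (negPf (b0 k.+1 _))//= => /eqP.
have [[|m] mq] := quasi_periodic_neq0 psiq psi0; last first.
  by rewrite (zero m (ltnW mq)).1 eqxx.
have := psiq 0%N; rewrite add0n.
have -> : psi q = 0 by case: (q) mq zero => // k _ zero; case: (zero k).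
by move/esym/eqP; rewrite mulf_eq0 (negPf y0)/= => ->.
Qed.

(** The monodromy multiplies the initial state by y b, where b is the product of the b_n. Its
    determinant is b times the product of the c_n, and the claim is its characteristic equation
    divided by y b. *)
Lemma chiral_bloch_trace mu y psi : mu != 0 -> y != 0 ->
  \prod_(n < q) chi_b om mu n != 0 -> chiral_bloch mu y psi ->
  chi_trace q om E mu = y * \prod_(n < q) chi_b om mu n +
    (\prod_(n < q) chi_c om mu n) / y.
Proof.
move=> mu0 y0 b0 psiB.
have := chi_transfer_state q psiB; rewrite (stateq psiB) scalerA.
rewrite (prod_chi_bS om_prim) mulrC => /mx2_char_root.
rewrite -/(chi_trace q om E mu) (det_chi_transfer q om E mu) (prod_chi_bS om_prim).
set b := \prod_(n < q) chi_b _ _ _ in b0 *.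
have s0 : state psi 0%N != 0.
  apply/eqP => /matrixP s0; have := s0 0 0; have := s0 1 0; rewrite !mxE/= => p0 p1.
  have := bloch1_neq0 y0 psiB _ (or_introl p0); rewrite p1 eqxx => /(_ _)/negP[]//.
  move=> n /andP[_ nq]; have /prodf_neq0/(_ (Ordinal nq)) := b0; exact.
move=> /(_ s0) h.
have {}h : chi_trace q om E mu * (y * b) = (y * b) ^+ 2 + b * \prod_(n < q) chi_c om mu n.
  by rewrite -[LHS]addr0 -[in LHS]h; ring.
apply: (mulIf (mulf_neq0 y0 b0)); by rewrite h; field.
Qed.

(* At mu = -1 both b_0 and c_0 vanish, and the Bloch condition degenerates. *)
Lemma chiral_bloch_trace0 y psi : y != 0 ->
  chiral_bloch (-1) y psi -> chi_trace q om E (-1) = 0.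
Proof.
move=> y0 psiB.
have b0 : chi_b om (-1) 0%N = 0 by rewrite /chi_b expr0 divr1 subrr.
have c0 : chi_c om (-1) 0%N = 0 by rewrite /chi_c expr0 invrN invr1 mulrN1 subrr.
have psi1 : psi 1%N != 0.
  apply: (bloch1_neq0 y0 psiB) => [n /andP[n0 nq]|]; last by right.
  rewrite /chi_b mulNr mul1r subr_eq0 eq_sym invr_eq1.
  by rewrite -(prim_order_dvd om_prim) gtnNdvd.
have := chi_transfer_state q psiB.
rewrite (prod_chi_bS om_prim) (bigD1 (Ordinal q0))//= b0 mul0r scale0r.
rewrite /chi_trace; set P := transfer _ q.
(* b_q = b_0 = 0 kills the last row of P, and c_0 = 0 its last column. The trace is the one
   remaining entry, and it annihilates psi_1. *)
have P10 j : P 1 j = 0.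
  rewrite /P -(prednK q0) transferS mxE big_ord_recl big_ord1 !mxE/=.
  by rewrite prednK// -[X in chi_b _ _ X]add0n (chi_bDq om_prim) b0 !mul0r addr0.
have P01 : P 0 1 = 0.
  rewrite /P -(prednK q0) transferSr mxE big_ord_recl big_ord1 !mxE/=.
  by rewrite c0 oppr0 !mulr0 addr0.
move=> /matrixP/(_ 0 0); rewrite (mx2E P) mul_mx2_state trace_mx2 !mxE/=.
by rewrite P01 P10 mul0r !addr0 => /eqP; rewrite mulf_eq0 (negPf psi1) orbF => /eqP.
Qed.

(** Converse of [chiral_bloch_trace]: the trace condition makes y b an eigenvalue of the monodromy,
    and an eigenvector generates the solution. *)
Lemma chiral_bloch_exists mu y : mu != 0 -> y != 0 ->
  \prod_(n < q) chi_b om mu n != 0 ->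
  chi_trace q om E mu = y * \prod_(n < q) chi_b om mu n +
    (\prod_(n < q) chi_c om mu n) / y ->
  exists psi, chiral_bloch mu y psi.
Proof.
move=> mu0 y0 b0 tr.
set b := \prod_(n < q) chi_b _ _ _ in b0 tr.
(* The genuine transfer matrices, with the division by b_(n+1); over a period this turns the
   eigenvalue y b into y. *)
pose T n := (chi_b om mu n.+1)^-1 *: chi_step om E mu n.
have TE k : transfer T k =
    (\prod_(n < k) chi_b om mu n.+1)^-1 *: transfer (chi_step om E mu) k.
  elim: k => [|k IH]; first by rewrite big_ord0 invr1 scale1r.
  rewrite !transferS IH big_ord_recr/= /T -scalemxAl -scalemxAr scalerA.
  by rewrite invfM mulrC.
have bn n : chi_b om mu n.+1 != 0.
  rewrite /chi_b -(prim_expr_mod om_prim) -/(chi_b om mu _).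
  have nq : (n.+1 %% q < q)%N by rewrite ltn_mod.
  by have /prodf_neq0/(_ (Ordinal nq)) := b0; exact.
have [w w0 Mw] : exists2 w : 'cV_2, w != 0 &
    transfer (chi_step om E mu) q *m w = (y * b) *: w.
  apply: mx2_eigenvector; rewrite -/(chi_trace q om E mu) tr.
  rewrite (det_chi_transfer q om E mu) (prod_chi_bS om_prim) -/b.
  by field.
have Tw : transfer T q *m w = y *: w.
  rewrite TE (prod_chi_bS om_prim) -/b -scalemxAl Mw scalerA.
  by rewrite mulrC mulfK.
have Tq n : T (n + q)%N = T n.
  by rewrite /T -addSn (chi_bDq om_prim) (chi_stepDq om_prim).
have TE2 m (r : 'cV[F]_2) : T m *m r = \col_i
    (if i == 0 then (chi_b om mu m.+1)^-1 * (E * r 0 0 - chi_c om mu m * r 1 0)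
     else r 0 0).
  rewrite /T -scalemxAl; apply/matrixP => [[[|[|?]] ?] j] //;
    rewrite !mxE big_ord_recl big_ord1 !mxE/= (ord1 j) ?mulNr.
    by congr (_ * (_ * r _ _ - _ * r _ _)); apply: val_inj.
  by rewrite mul0r addr0 mulKf//; congr (r _ _); apply: val_inj.
have per := transfer_eigen_periodic Tq Tw.
exists (fun k => (transfer T k *m w) 1 0); split.
- move=> n; rewrite !transferS -!mulmxA; move: (transfer T n *m w) => s.
  by rewrite !TE2 !mxE/= mulVKf// subrK.
- by move=> n; rewrite per mxE.
have [w1|w1] := eqVneq (w 1 0) 0; last by exists 0%N; rewrite mul1mx.
exists 1%N; rewrite transferS mulmx1 TE2 mxE/=; apply: contra w0 => /eqP w00.
apply/eqP/matrixP => [[[|[|?]] ?] j] //; rewrite mxE (ord1 j).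
  by rewrite -w00; congr (w _ _); apply: val_inj.
by rewrite -w1; congr (w _ _); apply: val_inj.
Qed.

End ChiralBloch.

(** * Spectra of hermitian matrices between two bounds *)

Section SpectralCounting.
Variable C : numClosedFieldType.
Local Open Scope sesquilinear_scope.

Lemma row_form_diag k n (A : 'M[C]_n) (X : 'M[C]_(k, n)) (e : 'rV[C]_k)
    (w : 'rV[C]_k) :
  X \is unitarymx -> X *m A = diag_mx e *m X ->
  ((w *m X) *m A *m (w *m X)^t*) 0 0 = \sum_i e 0 i * (w 0 i * (w 0 i)^*).
Proof.
move=> /unitarymxP XU XA.
rewrite -[w *m X *m A]mulmxA XA trmx_mul map_mxM !mulmxA.
rewrite -(mulmxA _ X) XU mulmx1 mxE; apply: eq_bigr => i _.
by rewrite mul_mx_diag !mxE mulrCA mulrA.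
Qed.

Lemma row_form1 k n (X : 'M[C]_(k, n)) (w : 'rV[C]_k) :
  X \is unitarymx ->
  ((w *m X) *m (w *m X)^t*) 0 0 = \sum_i w 0 i * (w 0 i)^*.
Proof.
move=> XU; rewrite -{1}[w *m X]mulmx1 (@row_form_diag _ _ _ _ (const_mx 1)) //.
  by apply: eq_bigr => i _; rewrite mxE mul1r.
by rewrite mulmx1 diag_const_mx mul1mx.
Qed.

Lemma spectral_rowsub n (A : 'M[C]_n) (I : {set 'I_n}) :
  A \is hermsymmx ->
  let X := rowsub (@enum_val _ (mem I)) (spectralmx A) in
  X \is unitarymx /\
  X *m A = diag_mx (colsub (@enum_val _ (mem I)) (spectral_diag A)) *m X.
Proof.
move=> Ah X; have PU := spectral_unitarymx A.
have /orthomx_spectralP AE := hermitian_normalmx Ah.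
split.
  apply/unitarymxP; apply/matrixP => i j.
  have /unitarymxP/matrixP/(_ (enum_val i) (enum_val j)) := PU.
  rewrite !mxE (inj_eq enum_val_inj) => <-.
  by apply: eq_bigr => l _; rewrite !mxE.
have PA : spectralmx A *m A = diag_mx (spectral_diag A) *m spectralmx A.
  by rewrite {2}AE !mulmxA mulmxV ?mul1mx// spectral_unit.
apply/matrixP => i j; rewrite mul_diag_mx !mxE.
have /matrixP/(_ (enum_val i) j) := PA; rewrite mul_diag_mx !mxE => <-.
by apply: eq_bigr => l _; rewrite !mxE.
Qed.

(** The hermitian form of A - E. *)
Definition qform n (A : 'M[C]_n) (E : C) (v : 'rV[C]_n) : C :=
  (v *m A *m v^t*) 0 0 - E * (v *m v^t*) 0 0.

Lemma qform_rows k n (A : 'M[C]_n) (X : 'M[C]_(k, n)) (e : 'rV[C]_k) E w :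
  X \is unitarymx -> X *m A = diag_mx e *m X ->
  qform A E (w *m X) = \sum_i (e 0 i - E) * (w 0 i * (w 0 i)^*).
Proof.
move=> XU XA; rewrite /qform (row_form_diag _ XU XA) row_form1// mulr_sumr.
by rewrite -sumrB; apply: eq_bigr => i _; rewrite mulrBl.
Qed.

Lemma weighted_sum_conj_ge0 k (e w : 'rV[C]_k) :
  (forall i, 0 < e 0 i) -> 0 <= \sum_i e 0 i * (w 0 i * (w 0 i)^*).
Proof.
by move=> e0; apply: sumr_ge0 => i _; rewrite mulr_ge0 ?mul_conjC_ge0// ltW.
Qed.

Lemma weighted_sum_conj_eq0 k (e w : 'rV[C]_k) :
  (forall i, 0 < e 0 i) -> \sum_i e 0 i * (w 0 i * (w 0 i)^*) = 0 -> w = 0.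
Proof.
move=> e0 /psumr_eq0P s0; apply/rowP => i; rewrite mxE.
have /eqP := s0 (fun i _ => mulr_ge0 (ltW (e0 i)) (mul_conjC_ge0 _)) i isT.
by rewrite mulf_eq0 gt_eqF//= mul_conjC_eq0 => /eqP.
Qed.

(** The rows of X are the orthonormal eigenvectors with eigenvalue above E, on whose span A - E is
    positive definite. *)
Lemma spectral_gt_rows n (A : 'M[C]_n) (E : C) : A \is hermsymmx ->
  exists X : 'M[C]_(#|[set i | E < spectral_diag A 0 i]|, n),
    (forall w, 0 <= qform A E (w *m X)) /\
    (forall w, qform A E (w *m X) = 0 -> w = 0).
Proof.
set I := [set i | _] => Ah; have [XU XA] := spectral_rowsub I Ah.
set X := rowsub _ _ in XU XA; set e := colsub _ _ in XA.
have e0 i : 0 < (e - const_mx E) 0 i.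
  by rewrite !mxE subr_gt0; have := enum_valP i; rewrite inE.
have key w : qform A E (w *m X) =
    \sum_i (e - const_mx E) 0 i * (w 0 i * (w 0 i)^*).
  by rewrite (qform_rows _ _ XU XA); apply: eq_bigr => i _; rewrite !mxE.
exists X; split=> w; rewrite key.
- exact: weighted_sum_conj_ge0.
- exact: weighted_sum_conj_eq0.
Qed.

Lemma spectral_lt_rows n (A : 'M[C]_n) (E : C) : A \is hermsymmx ->
  exists X : 'M[C]_(#|[set i | spectral_diag A 0 i < E]|, n),
    (forall w, qform A E (w *m X) <= 0) /\
    (forall w, qform A E (w *m X) = 0 -> w = 0).
Proof.
set I := [set i | _] => Ah; have [XU XA] := spectral_rowsub I Ah.
set X := rowsub _ _ in XU XA; set e := colsub _ _ in XA.
have e0 i : 0 < (const_mx E - e) 0 i.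
  by rewrite !mxE subr_gt0; have := enum_valP i; rewrite inE.
have key w : - qform A E (w *m X) =
    \sum_i (const_mx E - e) 0 i * (w 0 i * (w 0 i)^*).
  rewrite (qform_rows _ _ XU XA) -sumrN; apply: eq_bigr => i _.
  by rewrite !mxE -mulNr opprB.
exists X; split=> w.
  by rewrite -oppr_ge0 key weighted_sum_conj_ge0.
by move=> /(congr1 -%R); rewrite key oppr0; apply: weighted_sum_conj_eq0.
Qed.

Lemma qformN n (A : 'M[C]_n) E v : qform A E (- v) = qform A E v.
Proof. by rewrite /qform !linearN/= !mulNmx !map_mxN !mulmxN !opprK. Qed.

(** At a vector common to both row spaces, 0 <= A - E <= B - E <= 0, so both forms vanish there and
    definiteness makes its coordinates zero. *)
Lemma form_definite_rows_free k l n (A B : 'M[C]_n) (E : C)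
    (X : 'M[C]_(k, n)) (Y : 'M[C]_(l, n)) :
  (forall v, qform A E v <= qform B E v) ->
  (forall w, 0 <= qform A E (w *m X)) ->
  (forall w, qform A E (w *m X) = 0 -> w = 0) ->
  (forall w, qform B E (w *m Y) <= 0) ->
  (forall w, qform B E (w *m Y) = 0 -> w = 0) ->
  row_free (col_mx X Y).
Proof.
move=> AB X0 Xinj Y0 Yinj; apply: inj_row_free => w.
rewrite -[w]hsubmxK mul_row_col => /eqP; rewrite addr_eq0 => /eqP wX.
have := AB (lsubmx w *m X); rewrite {2}wX qformN => q3.
have B0 : qform B E (rsubmx w *m Y) = 0.
  by apply/le_anti; rewrite Y0 (le_trans (X0 _) q3).
have A0 : qform A E (lsubmx w *m X) = 0.
  by apply/le_anti; rewrite X0 andbT -B0.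
by rewrite (Xinj _ A0) (Yinj _ B0) row_mx0.
Qed.

(** Weyl monotonicity by a dimension count: the eigenvectors of A above E and those of B below E are
    jointly independent in dimension n. *)
Lemma spectral_count_le n (A B : 'M[C]_n) (E : C) :
  A \is hermsymmx -> B \is hermsymmx ->
  (forall v, qform A E v <= qform B E v) ->
  (#|[set i | (E < spectral_diag A 0 i)%R]| +
   #|[set i | (spectral_diag B 0 i < E)%R]| <= n)%N.
Proof.
move=> /(spectral_gt_rows E)[X [X0 Xinj]] /(spectral_lt_rows E)[Y [Y0 Yinj]] AB.
have /eqP <- := form_definite_rows_free AB X0 Xinj Y0 Yinj.
exact: rank_leq_col.
Qed.

(* If equality held, the eigenvector would be a sum x + y with M - E
   nonnegative at x and nonpositive at y, while being equal at x and y. *)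
Lemma spectral_count_lt n (A M B : 'M[C]_n) (E : C) (v : 'rV[C]_n) :
  A \is hermsymmx -> B \is hermsymmx -> M \is hermsymmx -> E \is Num.real ->
  (forall v, qform A E v <= qform M E v) ->
  (forall v, qform M E v <= qform B E v) ->
  v *m M = E *: v -> v != 0 ->
  (#|[set i | (E < spectral_diag A 0 i)%R]| +
   #|[set i | (spectral_diag B 0 i < E)%R]| < n)%N.
Proof.
move=> Ah Bh Mh Er AM MB vM.
rewrite ltn_neqAle (spectral_count_le Ah Bh (fun v => le_trans (AM v) (MB v))).
rewrite andbT; apply: contra => /eqP kl.
move: Ah Bh => /(spectral_gt_rows E)[X [X0 Xinj]] /(spectral_lt_rows E)[Y [Y0 Yinj]].
have free := form_definite_rows_free (fun v => le_trans (AM v) (MB v))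
  X0 Xinj Y0 Yinj.
have full : row_full (col_mx X Y) by rewrite /row_full (eqP free) kl.
have /submxP[w vE] := submx_full v full.
move: vE; rewrite -[w]hsubmxK mul_row_col => vE.
set x := lsubmx w *m X in vE; set y := rsubmx w *m Y in vE.
have Mt : M^t* = M by move/is_hermitianmxP: Mh; rewrite expr0 scale1r.
pose K := M - E%:M.
have qK u : qform M E u = (u *m K *m u^t*) 0 0.
  by rewrite /qform /K mulmxBr mulmxBl mul_mx_scalar -scalemxAl !mxE.
have vK : v *m K = 0 by rewrite /K mulmxBr vM mul_mx_scalar subrr.
have Kv : K *m v^t* = 0.
  have -> : K *m v^t* = (v *m M)^t* - (E *: v)^t*.
    rewrite /K mulmxBl mul_scalar_mx trmx_mul map_mxM Mt; congr (_ - _).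
    by apply/matrixP => i j; rewrite !mxE rmorphM/= (CrealP Er).
  by rewrite vM subrr.
(* K annihilates v = x + y from either side, so passing from x to y in both slots of the form costs
   two signs. *)
have xy : x *m K = - (y *m K).
  by apply/eqP; rewrite -addr_eq0 -mulmxDl -vE vK.
have yx : K *m x^t* = - (K *m y^t*).
  by apply/eqP; rewrite -addr_eq0 -mulmxDr -map_mxD -linearD/= -vE Kv.
have qxy : qform M E x = qform M E y.
  by rewrite !qK xy mulNmx -(mulmxA y) yx mulmxN opprK mulmxA.
have qx := le_trans (X0 (lsubmx w)) (AM _).
have qy := le_trans (MB _) (Y0 (rsubmx w)).
rewrite -/x -/y qxy in qx qy.
have My0 : qform M E y = 0 by apply/le_anti; rewrite qx qy.
have Ax0 : qform A E x = 0.
  by apply/le_anti; rewrite X0 andbT -My0 -qxy AM.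
have By0 : qform B E y = 0.
  by apply/le_anti; rewrite Y0 /= -My0 MB.
by rewrite vE /x /y (Xinj _ Ax0) (Yinj _ By0) !mul0mx addr0.
Qed.

End SpectralCounting.

(** * From eigenvalue counts to inequalities between sorted sequences *)

Section SortedCounting.
Variable R : realFieldType.
Implicit Types (s a b : seq R) (E : R).

Lemma sorted_count_gt s E i : sorted <=%O s -> (i < size s)%N -> E < s`_i ->
  (size s - i <= count (fun x => (E < x)%R) s)%N.
Proof.
move=> ss si Ei; rewrite -[s in count _ s](cat_take_drop i) count_cat -size_drop.
apply: leq_trans (leq_addl _ _); rewrite eq_leq//; apply/esym/eqP; rewrite -all_count; apply/(all_nthP 0) => j.
rewrite size_drop nth_drop => jlt; apply: (lt_le_trans Ei).
apply: (sorted_leq_nth le_trans le_refl) => //; rewrite ?inE ?leq_addr//.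
by rewrite -ltn_subRL.
Qed.

Lemma sorted_count_lt s E i : sorted <=%O s -> (i < size s)%N -> s`_i < E ->
  (i < count (fun x => (x < E)%R) s)%N.
Proof.
move=> ss si Ei; rewrite -[s in count _ s](cat_take_drop i.+1) count_cat.
have tk : size (take i.+1 s) = i.+1 by exact: size_takel.
apply: leq_trans (leq_addr _ _); rewrite -[X in (X <= _)%N]tk eq_leq//.
apply/esym/eqP; rewrite -all_count; apply/(all_nthP 0) => j.
rewrite tk => jlt; rewrite nth_take//; apply: le_lt_trans Ei.
apply: (sorted_leq_nth le_trans le_refl) => //; rewrite ?inE//.
by apply: leq_ltn_trans si.
Qed.

(** If a_i > b_i, then at their midpoint at least size - i entries of a lie above and i + 1 entries
    of b lie below, one too many. *)
Lemma sorted_nth_le a b : sorted <=%O a -> sorted <=%O b -> size a = size b ->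
  (forall E, (count (fun x => (E < x)%R) a + count (fun x => (x < E)%R) b <= size a)%N) ->
  forall i, (i < size a)%N -> a`_i <= b`_i.
Proof.
move=> sa sb sab cnt i ia; rewrite leNgt; apply/negP => ba.
have := cnt ((a`_i + b`_i) / 2).
have := @sorted_count_gt a ((a`_i + b`_i) / 2) i sa ia ltac:(lra).
have := @sorted_count_lt b ((a`_i + b`_i) / 2) i sb ltac:(by rewrite -sab) ltac:(lra).
lia.
Qed.

(** The index is the number k of entries of b below E: b_k < E would give k + 1 of them, and a_k > E
    would give size - k entries of a above E, against the strict bound. *)
Lemma sorted_nth_between a b E : sorted <=%O a -> sorted <=%O b ->
  size a = size b ->
  (count (fun x => (E < x)%R) a + count (fun x => (x < E)%R) b < size a)%N ->
  exists2 i, (i < size a)%N & a`_i <= E <= b`_i.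
Proof.
move=> sa sb sab cnt; set k := count (fun x => (x < E)%R) b in cnt.
have ka : (k < size a)%N by apply: leq_ltn_trans cnt; rewrite leq_addl.
have kb : (k < size b)%N by rewrite -sab.
exists k => //; apply/andP; split; rewrite leNgt; apply/negP => h.
  have := sorted_count_gt sa ka h; rewrite leqNgt => /negP[].
  by rewrite ltn_subRL addnC.
by have := sorted_count_lt sb kb h; rewrite -/k ltnn.
Qed.

End SortedCounting.

(** * Bands swept by eigenvalues between two hermitian bounds *)

Section SpectralBands.
Variable R : rcfType.
Local Open Scope complex_scope.
Local Open Scope sesquilinear_scope.

Lemma spectral_diag_Re n (A : 'M[R[i]]_n) i : A \is hermsymmx ->
  spectral_diag A 0 i = (complex.Re (spectral_diag A 0 i))%:C.
Proof.
move=> /hermitian_spectral_diag_real /mxOverP /(_ 0 i).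
by case/complex_realP => x ->.
Qed.

Definition sorted_spectrum n (A : 'M[R[i]]_n) : seq R :=
  sort <=%O (codom (fun i => complex.Re (spectral_diag A 0 i))).

Lemma size_sorted_spectrum n (A : 'M[R[i]]_n) : size (sorted_spectrum A) = n.
Proof. by rewrite size_sort size_codom card_ord. Qed.

Lemma sorted_sorted_spectrum n (A : 'M[R[i]]_n) :
  sorted <=%O (sorted_spectrum A).
Proof. exact: (sort_sorted le_total). Qed.

Lemma count_sorted_spectrum n (A : 'M[R[i]]_n) (p : pred R) :
  count p (sorted_spectrum A) =
  #|[set i | p (complex.Re (spectral_diag A 0 i))]|.
Proof.
have /permP -> : perm_eq (sorted_spectrum A)
    (codom (fun i => complex.Re (spectral_diag A 0 i))) by rewrite perm_sort.
by rewrite cardsE cardE {1}/enum_mem size_filter count_map -enumT.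
Qed.

Lemma sum_sorted_spectrum n (A : 'M[R[i]]_n) : A \is hermsymmx ->
  (\sum_(x <- sorted_spectrum A) x)%:C = \tr A.
Proof.
move=> Ah; rewrite /sorted_spectrum.
rewrite (perm_big (codom (fun i => complex.Re (spectral_diag A 0 i))));
  last by rewrite perm_sort.
rewrite big_image/=.
have /orthomx_spectralP {2}-> := hermitian_normalmx Ah.
rewrite -mulmxA mxtrace_mulC mulmxK ?spectral_unit// mxtrace_diag.
rewrite rmorph_sum; apply: eq_bigr => i _.
by rewrite [RHS]spectral_diag_Re.
Qed.

(** Here a and b are the sorted spectra of A and B. The strict count at an eigenvalue of M puts it
    in some band, and the traces give the total length. *)
Lemma spectral_bands n (A B : 'M[R[i]]_n) :
  A \is hermsymmx -> B \is hermsymmx ->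
  (forall v : 'rV_n, (v *m A *m v^t*) 0 0 <= (v *m B *m v^t*) 0 0) ->
  exists a b : seq R, [/\ size a = n, size b = n,
    forall i, (i < n)%N -> a`_i <= b`_i,
    (\sum_(i < n) (b`_i - a`_i))%:C = \tr B - \tr A &
    forall (M : 'M[R[i]]_n) (E : R) (v : 'rV_n), M \is hermsymmx ->
    (forall v : 'rV_n, (v *m A *m v^t*) 0 0 <= (v *m M *m v^t*) 0 0) ->
    (forall v : 'rV_n, (v *m M *m v^t*) 0 0 <= (v *m B *m v^t*) 0 0) ->
    v *m M = E%:C *: v -> v != 0 ->
    exists2 i, (i < n)%N & a`_i <= E <= b`_i].
Proof.
move=> Ah Bh AB; exists (sorted_spectrum A), (sorted_spectrum B).
have qf (X Y : 'M[R[i]]_n) (E : R) :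
    (forall v : 'rV_n, (v *m X *m v^t*) 0 0 <= (v *m Y *m v^t*) 0 0) ->
    forall v, qform X E%:C v <= qform Y E%:C v.
  by move=> XY v; rewrite /qform lerB.
have gtE E : #|[set i | E%:C < spectral_diag A 0 i]| =
    count (fun x => E < x) (sorted_spectrum A).
  rewrite count_sorted_spectrum; apply: eq_card => i.
  by rewrite !inE spectral_diag_Re// ltcR.
have ltE E : #|[set i | spectral_diag B 0 i < E%:C]| =
    count (fun x => x < E) (sorted_spectrum B).
  rewrite count_sorted_spectrum; apply: eq_card => i.
  by rewrite !inE spectral_diag_Re// ltcR.
have sA := size_sorted_spectrum A; have sB := size_sorted_spectrum B.
have ssA := sorted_sorted_spectrum A; have ssB := sorted_sorted_spectrum B.
split=> //.
- rewrite -{1}sA; apply: sorted_nth_le => //; first by rewrite sA sB.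
  move=> E; rewrite sA -gtE -ltE.
  exact: (spectral_count_le Ah Bh (qf _ _ E AB)).
- have sumE (X : 'M[R[i]]_n) : \sum_(x <- sorted_spectrum X) x =
      \sum_(i < n) (sorted_spectrum X)`_i.
    by rewrite (big_nth 0) size_sorted_spectrum big_mkord.
  by rewrite sumrB rmorphB/= -!sumE !sum_sorted_spectrum.
move=> M E v Mh AM MB vM v0; rewrite -{1}sA; apply: sorted_nth_between => //.
  by rewrite sA sB.
rewrite sA -gtE -ltE.
apply: (spectral_count_lt Ah Bh Mh _ (qf _ _ E AM) (qf _ _ E MB) vM v0).
by apply/complex_realP; exists E.
Qed.

End SpectralBands.

(** * Cyclic Jacobi matrices and bounds on their corner entry *)

Section CyclicJacobi.
Variable F : numClosedFieldType.
Local Open Scope sesquilinear_scope.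

Lemma hermsymmxP n (A : 'M[F]_n) : reflect (A^t* = A) (A \is hermsymmx).
Proof.
apply: (iffP (is_hermitianmxP _ _ _)); rewrite expr0 scale1r => h; first by rewrite -h.
by rewrite h.
Qed.

Lemma conjtrD m n (A B : 'M[F]_(m, n)) : (A + B)^t* = A^t* + B^t*.
Proof. by rewrite linearD/= map_mxD. Qed.

Lemma conjtrZ m n (a : F) (A : 'M[F]_(m, n)) : (a *: A)^t* = a^* *: A^t*.
Proof. by apply/matrixP => i j; rewrite !mxE rmorphM. Qed.

Lemma conjtr_delta m n (i : 'I_m) (j : 'I_n) :
  (delta_mx i j : 'M[F]_(m, n))^t* = delta_mx j i.
Proof. by apply/matrixP => k l; rewrite !mxE andbC conjC_nat. Qed.

Lemma mx11D (A B : 'M[F]_1) : (A + B) 0 0 = A 0 0 + B 0 0.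
Proof. by rewrite mxE. Qed.

Lemma mx11Z a (A : 'M[F]_1) : (a *: A) 0 0 = a * A 0 0.
Proof. by rewrite mxE. Qed.

Lemma row_formD n (A B : 'M[F]_n) (v : 'rV_n) :
  (v *m (A + B) *m v^t*) 0 0 = (v *m A *m v^t*) 0 0 + (v *m B *m v^t*) 0 0.
Proof. by rewrite mulmxDr mulmxDl mx11D. Qed.

Lemma row_formZ n a (A : 'M[F]_n) (v : 'rV_n) :
  (v *m (a *: A) *m v^t*) 0 0 = a * (v *m A *m v^t*) 0 0.
Proof. by rewrite -scalemxAr -scalemxAl mx11Z. Qed.

Lemma row_delta_form n (v w : 'rV[F]_n) i j :
  (v *m delta_mx i j *m w^t*) 0 0 = v 0 i * (w 0 j)^*.
Proof.
rewrite mxE (bigD1 j)//= big1 ?addr0 => [|k kj]; last first.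
  rewrite mxE big1 ?mul0r// => l _; rewrite mxE (negPf kj) andbF mulr0//.
rewrite !mxE (bigD1 i)//= big1 ?addr0 => [|k ki]; last first.
  by rewrite mxE (negPf ki) mulr0.
by rewrite mxE !eqxx mulr1.
Qed.

(** Completing the square: the expression is |z| times the squared modulus of (z/|z|) a + b. It
    compares the form of a corner entry z with |z| times that of the two end sites. *)
Lemma norm_form_ge0 (z a b : F) :
  0 <= `|z| * (a * a^* + b * b^*) + (z * (a * b^*) + z^* * (b * a^*)).
Proof.
have [->|z0] := eqVneq z 0; first by rewrite normr0 conjC0 !mul0r !addr0.
have nz0 : `|z| != 0 by rewrite normr_eq0.
have nn : `|z| * `|z| = z * z^* by rewrite -normCK expr2.
have nr : `|z|^* = `|z| by apply: CrealP; exact: normr_real.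
have -> : `|z| * (a * a^* + b * b^*) + (z * (a * b^*) + z^* * (b * a^*)) =
    `|z| * ((z / `|z| * a + b) * (z / `|z| * a + b)^*).
  rewrite rmorphD !rmorphM fmorphV/= nr.
  have -> : z * (a * b^*) + z^* * (b * a^*) =
      `|z| * (z / `|z| * (a * b^*) + z^* / `|z| * (b * a^*)) by field.
  rewrite -mulrDr; congr (_ * _).
  have -> : a * a^* = (z * z^*) / (`|z| * `|z|) * (a * a^*).
    by rewrite -nn divff ?mul1r// mulf_neq0.
  by field.
by rewrite mulr_ge0// mul_conjC_ge0.
Qed.

Variables (n : nat) (b : nat -> F).

(** Eigenvectors are rows, so the coefficient of the next site sits below the diagonal. *)
Definition jacobi_lower : 'M[F]_n.+1 :=
  \matrix_(i, j) if i == j.+1 :> nat then b i else 0.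

Definition jacobi_chain := jacobi_lower + jacobi_lower^t*.

(** For n = 0 the two summands coincide, so that the trace is 2 in this case as well. *)
Definition jacobi_ends : 'M[F]_n.+1 :=
  delta_mx ord0 ord0 + delta_mx ord_max ord_max.

Definition jacobi_wrap (z : F) : 'M[F]_n.+1 :=
  z *: delta_mx ord0 ord_max + z^* *: delta_mx ord_max ord0.

Lemma jacobi_chain_herm : jacobi_chain^t* = jacobi_chain.
Proof. by rewrite /jacobi_chain conjtrD trmxCK addrC. Qed.

Lemma jacobi_ends_herm : jacobi_ends^t* = jacobi_ends.
Proof. by rewrite /jacobi_ends conjtrD !conjtr_delta. Qed.

Lemma jacobi_wrap_herm z : (jacobi_wrap z)^t* = jacobi_wrap z.
Proof. by rewrite /jacobi_wrap conjtrD !conjtrZ !conjtr_delta conjCK addrC. Qed.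

Lemma jacobi_bound_herm (r : F) : r \is Num.real ->
  jacobi_chain + r *: jacobi_ends \is hermsymmx.
Proof.
move=> rr; apply/hermsymmxP.
by rewrite conjtrD conjtrZ jacobi_chain_herm jacobi_ends_herm (CrealP rr).
Qed.

Lemma jacobi_wrapped_herm z : jacobi_chain + jacobi_wrap z \is hermsymmx.
Proof. by apply/hermsymmxP; rewrite conjtrD jacobi_chain_herm jacobi_wrap_herm. Qed.

Lemma form_jacobi_ends (v : 'rV_n.+1) : (v *m jacobi_ends *m v^t*) 0 0 =
  v 0 ord0 * (v 0 ord0)^* + v 0 ord_max * (v 0 ord_max)^*.
Proof. by rewrite row_formD !row_delta_form. Qed.

Lemma form_jacobi_wrap z (v : 'rV_n.+1) : (v *m jacobi_wrap z *m v^t*) 0 0 =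
  z * (v 0 ord0 * (v 0 ord_max)^*) + z^* * (v 0 ord_max * (v 0 ord0)^*).
Proof.
by rewrite row_formD !row_formZ !row_delta_form.
Qed.

Lemma jacobi_wrapped_le z (v : 'rV_n.+1) :
  (v *m (jacobi_chain + jacobi_wrap z) *m v^t*) 0 0 <=
  (v *m (jacobi_chain + `|z| *: jacobi_ends) *m v^t*) 0 0.
Proof.
rewrite !(row_formD jacobi_chain) lerD2l row_formZ.
rewrite form_jacobi_ends form_jacobi_wrap.
have := norm_form_ge0 (- z) (v 0 ord0) (v 0 ord_max).
by rewrite normrN rmorphN !mulNr -opprD subr_ge0.
Qed.

Lemma jacobi_wrapped_ge z (v : 'rV_n.+1) :
  (v *m (jacobi_chain + (- `|z|) *: jacobi_ends) *m v^t*) 0 0 <=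
  (v *m (jacobi_chain + jacobi_wrap z) *m v^t*) 0 0.
Proof.
rewrite !(row_formD jacobi_chain) lerD2l row_formZ.
rewrite form_jacobi_ends form_jacobi_wrap.
by rewrite mulNr -subr_ge0 opprK addrC norm_form_ge0.
Qed.

Lemma trace_jacobi_bound (r : F) :
  \tr (jacobi_chain + r *: jacobi_ends) - \tr (jacobi_chain + (- r) *: jacobi_ends)
  = 4 * r.
Proof.
have tr_delta (i : 'I_n.+1) : \tr (delta_mx i i : 'M[F]_n.+1) = 1.
  rewrite /mxtrace (bigD1 i)//= big1 ?addr0 ?mxE ?eqxx// => j ji.
  by rewrite mxE (negPf ji).
by rewrite !mxtraceD !mxtraceZ mxtraceD !tr_delta; ring.
Qed.

(** Coordinate i holds psi_(i+1). The chain gives the recursion away from the two ends, where the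
    corner supplies b_(n+1) psi_(n+2) = b_0 y psi_1 and, as y has modulus 1, the term of psi_0. *)
Lemma jacobi_wrapped_eigen (E y : F) (psi : nat -> F) :
  (forall k, E * psi k.+1 = b k.+1 * psi k.+2 + (b k)^* * psi k) ->
  (forall k, psi (k + n.+1)%N = y * psi k) -> b n.+1 = b 0%N -> y * y^* = 1 ->
  let v : 'rV_n.+1 := \row_i psi i.+1 in
  v *m (jacobi_chain + jacobi_wrap (b 0%N * y)) = E *: v.
Proof.
move=> psiE psiq bq yy v; apply/rowP => j.
have low : (v *m jacobi_lower) 0 j = if (j < n)%N then b j.+1 * psi j.+2 else 0.
  rewrite mxE; case: ltnP => jn.
    rewrite (bigD1 (Ordinal (jn : (j.+1 < n.+1)%N)))//= !mxE eqxx big1 ?addr0.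
      by rewrite mulrC.
    move=> i; rewrite -val_eqE/= => /negPf ij; rewrite !mxE ij mulr0//.
  rewrite big1// => i _; rewrite !mxE; case: eqP => [ij|]; last by rewrite mulr0.
  by have := ltn_ord i; rewrite ij ltnS ltnNge jn.
have upp : (v *m jacobi_lower^t*) 0 j =
    if (0 < j)%N then (b j)^* * psi j else 0.
  rewrite mxE; case: ltnP => j0.
    have jn : (j.-1 < n.+1)%N by rewrite (leq_ltn_trans (leq_pred j)).
    rewrite (bigD1 (Ordinal jn))//= !mxE/= prednK// eqxx big1 ?addr0.
      by rewrite mulrC.
    move=> i; rewrite -val_eqE/= => ij; rewrite !mxE; case: eqP => [ji|].
      by rewrite ji/= eqxx in ij.
    by rewrite conjC0 mulr0.
  rewrite big1// => i _; rewrite !mxE; case: eqP => [ij|].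
    by rewrite ij in j0.
  by rewrite conjC0 mulr0.
have wr1 : (v *m delta_mx ord0 ord_max) 0 j = if j == n :> nat then psi 1%N else 0.
  rewrite mxE (bigD1 ord0)//= big1 ?addr0.
    by rewrite !mxE eqxx -val_eqE/=; case: eqP => _; rewrite ?mulr1 ?mulr0.
  by move=> i i0; rewrite !mxE (negPf i0) mulr0.
have wr2 : (v *m delta_mx ord_max ord0) 0 j = if j == 0%N :> nat then psi n.+1 else 0.
  rewrite mxE (bigD1 ord_max)//= big1 ?addr0.
    by rewrite !mxE eqxx -val_eqE/=; case: eqP => _; rewrite ?mulr1 ?mulr0.
  by move=> i i0; rewrite !mxE (negPf i0) mulr0.
rewrite mulmxDr mxE /jacobi_chain mulmxDr mxE low upp /jacobi_wrap mulmxDr mxE.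
rewrite -!scalemxAr [X in _ + (X + _)]mxE [X in _ + (_ + X)]mxE wr1 wr2.
rewrite !mxE psiE addrACA; congr (_ + _).
  have := ltn_ord j; rewrite ltnS; case: ltngtP => // [jn _|->]; first by rewrite mulr0 addr0.
  rewrite bq add0r -mulrA => _; congr (_ * _).
  by rewrite -(psiq 1%N) add1n.
case: posnP => [->|_]; last by rewrite mulr0 addr0.
by rewrite add0r -[n.+1]add0n psiq rmorphM -mulrA [y^* * _]mulrA [y^* * y]mulrC yy mul1r.
Qed.

End CyclicJacobi.

(** * Resolvents of periodic Schrodinger operators on l2Z *)

Import numFieldNormedType.Exports.
Import ComplexField.Normc.
Local Open Scope classical_set_scope.
Local Open Scope ring_scope.
Local Open Scope complex_scope.

Lemma cvg_geometric_increments (R : realType) (x : R^nat) (c r : R) :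
  0 <= r < 1 -> (forall k, `|x k.+1 - x k| <= c * r ^+ k) ->
  cvgn x.
Proof.
move=> /andP[r0 r1] xc.
have sx : cvgn (series (fun k => x k.+1 - x k)).
  apply: normed_cvg.
  apply: (@series_le_cvg _ _ (geometric c r)) => //.
  - by move=> k; exact: normr_ge0.
  - by move=> k; exact: le_trans (xc k).
  - by apply: is_cvg_geometric_series; rewrite ger0_norm.
have -> : x = cst (x 0%N) + series (fun k => x k.+1 - x k).
  apply/funext => n; rewrite [RHS]/(x 0%N + series _ n) /series/= telescope_sumr//.
  by rewrite [RHS]addrC subrK.
by apply: is_cvgD => //; exact: is_cvg_cst.
Qed.

(** * Inverting 1 - r S^a by Neumann series, and a criterion for the resolvent set *)

Section L2Shift.
Variable R : realType.
Implicit Types (u v f g : l2Z R) (r : R) (a : int).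

Lemma normc_l2_le u n : normc (u n) <= l2norm u.
Proof.
rewrite -ler_sqr ?nnegrE ?l2norm_ge0 ?normc_pos// -lee_fin l2norm_sq.
apply: esum_ge; exists [set n]; first by split => //; exact: finite_set1.
by rewrite fsbig_set1.
Qed.

Definition l2shift a u : l2Z R := L2Z (square_summable_shift a (l2valP u)).

Lemma l2shift_is_linear a : linear (l2shift a).
Proof. by move=> c u v; apply: val_inj; apply/funext. Qed.
HB.instance Definition _ a :=
  GRing.isLinear.Build _ _ _ _ _ (l2shift_is_linear a).

Lemma l2norm_shift a u : l2norm (l2shift a u) = l2norm u.
Proof. by rewrite /l2norm [sqsum _]sqsum_shift. Qed.

Lemma normc_real r : normc r%:C = `|r|.
Proof. by rewrite -[r%:C]mulr1 normc_realM [normc 1]normc1 mulr1. Qed.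

Lemma l2norm_real_shift a r u :
  l2norm (r%:C *: l2shift a u) = `|r| * l2norm u.
Proof.
by rewrite l2normZ l2norm_shift normc_real.
Qed.

Lemma l2norm0 : l2norm (0 : l2Z R) = 0.
Proof. by rewrite -(scale0r (0 : l2Z R)) l2normZ normc0 mul0r. Qed.

(** Partial sums, in Horner form, of the Neumann series of the inverse of 1 - r S^a. *)
Fixpoint shift_partial a r f (N : nat) : l2Z R :=
  if N is N'.+1 then f + r%:C *: l2shift a (shift_partial a r f N') else 0.

Lemma l2norm_shift_partial a r f N : `|r| < 1 ->
  l2norm (shift_partial a r f N) <= l2norm f / (1 - `|r|).
Proof.
move=> r1; have r1' : 0 < 1 - `|r| by rewrite subr_gt0.
elim: N => [|N IH] /=.
  by rewrite l2norm0 divr_ge0 ?l2norm_ge0// ltW.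
apply: le_trans (l2norm_triangle _ _) _.
rewrite l2norm_real_shift.
have -> : l2norm f / (1 - `|r|) = l2norm f + `|r| * (l2norm f / (1 - `|r|)).
  by field; rewrite gt_eqF.
by rewrite lerD2l ler_wpM2l.
Qed.

Lemma l2norm_shift_partialB a r f N :
  l2norm (shift_partial a r f N.+1 - shift_partial a r f N) =
  l2norm f * `|r| ^+ N.
Proof.
elim: N => [|N IH]; first by rewrite /= linear0 scaler0 addr0 subr0 expr0 mulr1.
rewrite exprS mulrCA -IH -(l2norm_real_shift a); congr l2norm.
by rewrite linearB/= scalerBr opprD addrACA subrr add0r.
Qed.

Lemma Re_le_normc (z : R[i]) : `|complex.Re z| <= normc z.
Proof.
by case: z => x y /=; rewrite -sqrtr_sqr ler_sqrt ?lerDl ?addr_ge0 ?sqr_ge0.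
Qed.

Lemma Im_le_normc (z : R[i]) : `|complex.Im z| <= normc z.
Proof.
by case: z => x y /=; rewrite -sqrtr_sqr ler_sqrt ?lerDr ?addr_ge0 ?sqr_ge0.
Qed.

Lemma normc_ReIm (z : R[i]) :
  normc z ^+ 2 = complex.Re z ^+ 2 + complex.Im z ^+ 2.
Proof. by case: z => x y /=; rewrite sqr_sqrtr// addr_ge0 ?sqr_ge0. Qed.

(** Fatou's argument: each finite sum of squares is at most K^2 along the sequence, hence also in
    the limit. *)
Lemma l2_pointwise_limit (F : nat -> l2Z R) (g : int -> R[i]) (K : R) :
  (forall N, l2norm (F N) <= K) ->
  (forall n, complex.Re (F N n) @[N --> \oo] --> complex.Re (g n)) ->
  (forall n, complex.Im (F N n) @[N --> \oo] --> complex.Im (g n)) ->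
  g \in square_summable.
Proof.
move=> FK gre gim; rewrite inE.
apply: (@le_lt_trans _ _ (K ^+ 2)%:E); last exact: ltry.
have K0 : 0 <= K by apply: le_trans (FK 0%N); exact: l2norm_ge0.
apply: ge_ereal_sup => _ [S [finS _] <-].
rewrite fsbig_finite//= sumEFin lee_fin.
apply: (@cvgr_to_le _ \oo _ _
  (fun N => \sum_(i <- finmap.enum_fset (fset_set S)) normc (F N i) ^+ 2)).
- apply: cvg_big => [|i _]; first exact: add_continuous.
  under eq_cvg do rewrite normc_ReIm.
  by rewrite normc_ReIm; apply: cvgD; rewrite expr2; apply: cvgM.
- near=> N; apply: le_trans (_ : l2norm (F N) ^+ 2 <= _).
    rewrite -lee_fin l2norm_sq -sumEFin -fsbig_finite//.
    by apply: ereal_sup_ubound; exists S.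
  by rewrite ler_sqr ?nnegrE ?l2norm_ge0.
Unshelve. all: by end_near. Qed.

(** The Neumann series converges at each site, its increments being geometric. The uniform bound on
    the partial sums puts the limit in l2, and their recursion passes to the limit. *)
Lemma sub_shift_surj a r f : `|r| < 1 ->
  exists g, g - r%:C *: l2shift a g = f.
Proof.
move=> r1; pose F := shift_partial a r f.
have inc n N : normc (F N.+1 n - F N n) <= l2norm f * `|r| ^+ N.
  rewrite -(l2norm_shift_partialB a).
  exact: (normc_l2_le (F N.+1 - F N)).
have r01 : 0 <= `|r| < 1 by rewrite normr_ge0.
have cre n : cvgn (fun N => complex.Re (F N n)).
  apply: (@cvg_geometric_increments _ _ (l2norm f) `|r|) => // N.
  apply: le_trans (inc n N); apply: le_trans (Re_le_normc _).
  by case: (F N.+1 n) (F N n) => [? ?] [? ?].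
have cim n : cvgn (fun N => complex.Im (F N n)).
  apply: (@cvg_geometric_increments _ _ (l2norm f) `|r|) => // N.
  apply: le_trans (inc n N); apply: le_trans (Im_le_normc _).
  by case: (F N.+1 n) (F N n) => [? ?] [? ?].
pose g n : R[i] := limn (fun N => complex.Re (F N n)) +i*
                   limn (fun N => complex.Im (F N n)).
have gl : g \in square_summable.
  apply: (@l2_pointwise_limit F g (l2norm f / (1 - `|r|))) => //.
  by move=> N; exact: l2norm_shift_partial.
exists (L2Z gl); apply: val_inj; apply/funext => n /=.
suff gE : g n = f n + r%:C * g (n + a).
  by rewrite [LHS](_ : _ = g n - r%:C * g (n + a))// gE addrK.
have FE N : F N.+1 n = f n + r%:C * F N (n + a) by [].
have FRe N : complex.Re (F N.+1 n) =
    complex.Re (f n) + r * complex.Re (F N (n + a)).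
  by rewrite FE; case: (f n) (F N (n + a)) => [? ?] [? ?] /=; rewrite mul0r subr0.
have FIm N : complex.Im (F N.+1 n) =
    complex.Im (f n) + r * complex.Im (F N (n + a)).
  by rewrite FE; case: (f n) (F N (n + a)) => [? ?] [? ?] /=; rewrite mul0r addr0.
have limE (x y : R^nat) (c : R) : cvgn x -> cvgn y ->
    (forall N, x N.+1 = c + r * y N) -> limn x = c + r * limn y.
  move=> cx cy xy; apply/cvg_lim => //; rewrite -(cvg_shiftS x).
  rewrite (_ : [sequence x n.+1]_n = (fun N => c + r * y N)); last by apply/funext.
  by apply: cvgD; [exact: cvg_cst | apply: cvgM => //; exact: cvg_cst].
rewrite /g (limE _ _ _ (cre n) (cre (n + a)) FRe).
rewrite (limE _ _ _ (cim n) (cim (n + a)) FIm).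
by case: (f n) => x y; apply/eqP; rewrite eq_complex /= mul0r subr0 mul0r addr0 !eqxx.
Qed.

Lemma sub_shift_lower_bound a r g :
  (1 - `|r|) * l2norm g <= l2norm (g - r%:C *: l2shift a g).
Proof.
rewrite mulrBl mul1r lerBlDr -(l2norm_real_shift a).
by rewrite -{1}[g](subrK (r%:C *: l2shift a g)) l2norm_triangle.
Qed.

(** The lower bound gives both injectivity, which makes the choice of preimages linear, and the
    continuity of the inverse. *)
Lemma resolvent_set_bijective (T : {linear l2Z R -> l2Z R}) (z : R[i]) (c : R) :
  (forall f, exists u, T u - z *: u = f) ->
  (forall u, l2norm u <= c * l2norm (T u - z *: u)) ->
  resolvent_set T z.
Proof.
move=> surj bdd.
have /choice[B BE] := surj.
have inj u v : T u - z *: u = T v - z *: v -> u = v.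
  move=> uv; apply/eqP; rewrite -subr_eq0; apply/eqP/l2norm_eq0/eqP.
  rewrite eq_le l2norm_ge0 andbT; apply: le_trans (bdd _) _.
  have -> : T (u - v) - z *: (u - v) = (T u - z *: u) - (T v - z *: v).
    by rewrite linearB scalerBr/= !opprD !opprK addrACA.
  by rewrite uv subrr l2norm0 mulr0.
have Blin : linear B.
  move=> k u v; apply: inj; rewrite BE linearD linearZ/=.
  rewrite scalerDr opprD addrACA BE scalerA mulrC -scalerA -scalerBr BE//.
pose BL := GRing.isLinear.Build _ _ _ _ B Blin.
pose B' : {linear l2Z R -> l2Z R} := HB.pack B BL.
exists B'; split.
- apply/linear_bounded_continuous/linear_boundedP.
  exists `|c|%:C; split; first by rewrite complex_real.
  move=> x cx u; apply: le_trans (ler_wpM2r _ (ltW cx)) => //.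
  rewrite [leLHS](_ : _ = (l2norm (B u))%:C)// [leRHS](_ : _ = (`|c| * l2norm u)%:C); last first.
    by rewrite rmorphM.
  rewrite lecR; apply: le_trans (bdd (B u)) _.
  by rewrite BE ler_wpM2r ?l2norm_ge0// ler_norm.
- by move=> u /=; apply: inj; rewrite BE.
- by move=> u /=; rewrite BE.
Qed.
End L2Shift.

(** * Polynomials of a periodic operator and its discriminant *)

Section PeriodicSchrodinger.
Variables (R : realType) (v : int -> R) (q : nat).
Hypothesis vq : forall n, v (n + q%:Z) = v n.
Variable H : {linear l2Z R -> l2Z R}.
Hypothesis HE : forall u n, H u n = u (n - 1) + u (n + 1) + (v n)%:C * u n.
Variable C : R.
Hypothesis HC : forall u, l2norm (H u) <= C * l2norm u.
Implicit Types (u : l2Z R) (p : {poly R}) (n : int) (E r : R).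

Definition hpoly p u : l2Z R := \sum_(i < size p) (p`_i)%:C *: iter i H u.

Lemma hpoly_widen N p u : (size p <= N)%N ->
  hpoly p u = \sum_(i < N) (p`_i)%:C *: iter i H u.
Proof.
move=> pN; rewrite /hpoly (big_ord_widen _ (fun i => (p`_i)%:C *: iter i H u) pN).
rewrite big_mkcond; apply: eq_bigr => i _; case: ltnP => // ip.
by rewrite nth_default// scale0r.
Qed.

Lemma hpolyD p p' u : hpoly (p + p') u = hpoly p u + hpoly p' u.
Proof.
pose N := maxn (size p) (size p').
rewrite !(@hpoly_widen N) ?leq_maxl ?leq_maxr ?size_polyD//.
by rewrite -big_split; apply: eq_bigr => i _; rewrite coefD rmorphD scalerDl.
Qed.

Lemma hpolyZ r p u : hpoly (r *: p) u = r%:C *: hpoly p u.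
Proof.
rewrite (@hpoly_widen (size p)) ?size_scale_leq// scaler_sumr.
by apply: eq_bigr => i _; rewrite coefZ rmorphM scalerA.
Qed.

Lemma hpolyN p u : hpoly (- p) u = - hpoly p u.
Proof. by rewrite -scaleN1r hpolyZ rmorphN1 scaleN1r. Qed.

Lemma hpoly_iterS p u : hpoly p (H u) = H (hpoly p u).
Proof.
by rewrite linear_sum; apply: eq_bigr => i _; rewrite linearZ/= -iterSr.
Qed.

Lemma hpolyB p u w : hpoly p (u - w) = hpoly p u - hpoly p w.
Proof.
rewrite /hpoly -sumrB; apply: eq_bigr => i _; rewrite -scalerBr; congr (_ *: _).
by elim: (val i) => //= k ->; rewrite linearB.
Qed.

Lemma hpolyZr p (c : R[i]) u : hpoly p (c *: u) = c *: hpoly p u.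
Proof.
rewrite /hpoly scaler_sumr; apply: eq_bigr => i _.
rewrite scalerA mulrC -scalerA; congr (_ *: _).
by elim: (val i) => //= k ->; rewrite linearZ.
Qed.

Lemma hpolyMX p u : hpoly (p * 'X) u = H (hpoly p u).
Proof.
rewrite (@hpoly_widen (size p).+1); last by rewrite (leq_trans (size_polyMleq _ _))// size_polyX addn2.
rewrite big_ord_recl coefMX/= scale0r add0r -hpoly_iterS.
by apply: eq_bigr => i _; rewrite coefMX/= -iterSr.
Qed.

Lemma hpolyC r u : hpoly r%:P u = r%:C *: u.
Proof.
rewrite (@hpoly_widen 1) ?size_polyC ?leq_b1//.
by rewrite big_ord1 coefC.
Qed.

Lemma l2norm_hpoly p : exists2 K, 0 <= K & forall u, l2norm (hpoly p u) <= K * l2norm u.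
Proof.
have C0 : 0 <= Num.max 0 C by rewrite le_max lexx.
have iterC i u : l2norm (iter i H u) <= Num.max 0 C ^+ i * l2norm u.
  elim: i => [|i IH]; first by rewrite mul1r.
  apply: le_trans (HC _) _; rewrite exprS -mulrA.
  apply: le_trans (_ : Num.max 0 C * l2norm (iter i H u) <= _).
    by rewrite ler_wpM2r ?l2norm_ge0// le_max lexx orbT.
  by rewrite ler_wpM2l.
exists (\sum_(i < size p) `|p`_i| * Num.max 0 C ^+ i).
  by apply: sumr_ge0 => i _; rewrite mulr_ge0 ?exprn_ge0.
move=> u; rewrite /hpoly mulr_suml.
elim/big_ind2 : _ => [|x a y b xa yb|i _]; first by rewrite l2norm0.
  by apply: le_trans (l2norm_triangle _ _) _; exact: lerD.
rewrite l2normZ normc_real -mulrA.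
by rewrite ler_wpM2l.
Qed.

Definition poly_step n (i : nat) : 'M[{poly R}]_2 :=
  mx2 ('X - (v (n + i%:Z))%:P) (-1) 1 0.

(* The functionals p |-> (p(H) u) n satisfy, in n, the recursion of the solutions
   of H u = E u with multiplication by 'X in place of E. *)
Lemma hpoly_transfer u n k (a b : {poly R}) :
  hpoly a u (n + k%:Z) + hpoly b u (n + k%:Z - 1) =
  let T := transfer (poly_step n) k in
  hpoly (a * T 0 0 + b * T 1 0) u n + hpoly (a * T 0 1 + b * T 1 1) u (n - 1).
Proof.
elim: k a b => [|k IH] a b /=.
  by rewrite !mxE/= !mulr1 !mulr0 addr0 add0r addr0.
have -> : n + k.+1%:Z = n + k%:Z + 1 by rewrite -addn1 PoszD addrA.
rewrite addrK.
set m := n + k%:Z.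
have step : hpoly a u (m + 1) + hpoly b u m =
    hpoly (a * ('X - (v m)%:P) + b) u m + hpoly (- a) u (m - 1).
  rewrite hpolyD hpolyN mulrBr hpolyD hpolyN hpolyMX mulrC mul_polyC hpolyZ.
  rewrite [(_ + hpoly b u) m](_ : _ = H (hpoly a u) m - (v m)%:C * hpoly a u m + hpoly b u m)//.
  by rewrite HE [X in _ = _ + X](_ : _ = - hpoly a u (m - 1))//; ring.
rewrite step IH /=; set T := transfer _ k.
rewrite (mx2E T) /poly_step mulmx2 -/m !mxE/=.
by congr (hpoly _ u n + hpoly _ u (n - 1)); ring.
Qed.

Definition poly_trace n := \tr (transfer (poly_step n) q).

Lemma poly_step_periodic n i : poly_step (n + q%:Z) i = poly_step n i.
Proof. by rewrite /poly_step addrAC vq. Qed.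

Lemma poly_trace_shift n : poly_trace (n + 1) = poly_trace n.
Proof.
rewrite /poly_trace -[RHS]trace_transfer_shift; last first.
  by rewrite /poly_step vq addr0.
congr mxtrace; apply: eq_transfer => i _.
by rewrite /poly_step -addrA -PoszD add1n.
Qed.

Lemma poly_traceE n : poly_trace n = poly_trace 0.
Proof.
elim/int_rect: n => [//|n IH|n IH].
  by rewrite -IH -addn1 PoszD poly_trace_shift.
by rewrite -IH -addn1 PoszD opprD -[LHS]poly_trace_shift subrK.
Qed.

(** Cayley-Hamilton for the monodromy M, of determinant 1: M^2 = t M - 1. Applied from site n - q,
    M^2 yields u at n + q, t M yields t(H) u at n, and 1 yields u at n - q. *)
Lemma hpoly_trace u n :
  hpoly (poly_trace 0) u n = u (n + q%:Z) + u (n - q%:Z).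
Proof.
set m := n - q%:Z.
have nE : n = m + q%:Z by rewrite subrK.
have h1 w k : hpoly 1 w k = w k by rewrite -[1]/(1%:P) hpolyC scale1r.
pose M := transfer (poly_step m) q.
have MM : M *m M = poly_trace 0 *: M - 1%:M.
  rewrite mx2_Cayley_Hamilton -(poly_traceE m); congr (_ - _%:M).
  by rewrite det_transfer big1// => i _; rewrite det_mx2; ring.
have step1 (a b : {poly R}) := hpoly_transfer u m q a b.
have step2 (a b : {poly R}) := hpoly_transfer u n q a b.
have h0 k : hpoly 0 u k = 0 by rewrite -[0]/(0%:P) hpolyC scale0r.
have Mn : transfer (poly_step n) q = M.
  by apply: eq_transfer => i _; rewrite nE poly_step_periodic.
have := step2 1 0; rewrite h0 h1 addr0 /= Mn !mul1r !mul0r !addr0.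
have := step1 (M 0 0) (M 0 1); rewrite -nE /= -/M => -> ->.
have e00 : M 0 0 * M 0 0 + M 0 1 * M 1 0 = poly_trace 0 * M 0 0 - 1.
  have /matrixP/(_ 0 0) := MM; rewrite {1 2}(mx2E M) mulmx2 !mxE/= => ->; ring.
have e01 : M 0 0 * M 0 1 + M 0 1 * M 1 1 = poly_trace 0 * M 0 1.
  by have /matrixP/(_ 0 1) := MM; rewrite {1 2}(mx2E M) mulmx2 !mxE/= => ->; ring.
rewrite e00 e01 hpolyD hpolyN.
have := step1 (poly_trace 0) 0.
rewrite h0 addr0 -nE /= !mul0r !addr0 -/M => ->.
set a := hpoly (_ * M 0 0) u; set b := hpoly (_ * M 0 1) u.
change (a m + b (m - 1) = a m - hpoly 1 u m + b (m - 1) + u m).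
by rewrite h1; ring.
Qed.

Definition trace_at E := \tr (transfer (fun i => mx2 (E - v i%:Z) (-1) 1 0) q).

Lemma horner_poly_trace E : (poly_trace 0).[E] = trace_at E.
Proof.
rewrite /poly_trace /trace_at -[LHS]/(horner_eval E _) -trace_map_mx map_transfer.
congr mxtrace; apply: eq_transfer => i _.
by rewrite map_mx2 /= /horner_eval !hornerE.
Qed.

(** Let r be the root of r^2 - t r + 1 of modulus below 1, for t = t(E). As t(H) = S^q + S^-q, the
    operator -r (t(H) - t) factors as (1 - r S^q) (1 - r S^-q) and is invertible. Since t(H) - t =
    (H - E) Q(H) with commuting factors, H - E is invertible too. *)
Lemma resolvent_set_trace_gt2 E : 2 < `|trace_at E| -> resolvent_set H E%:C.
Proof.
set t := trace_at E => t2.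
have [r r0 [r1 rt]] : exists2 r, r != 0 & `|r| < 1 /\ r ^+ 2 + 1 = t * r.
  have t4 : 0 <= t ^+ 2 - 4 by move: t2; case: (ger0P t) => ? ?; nra.
  have s0 := sqrtr_ge0 (t ^+ 2 - 4); have := sqr_sqrtr t4.
  set s := Num.sqrt _ in s0 * => sE.
  have t0 : 0 <= `|t| by [].
  have tn : `|t| ^+ 2 = t ^+ 2 by rewrite real_normK ?num_real.
  have st : s < `|t| by rewrite -ltr_sqr ?nnegrE// sE tn; lra.
  have ts : `|t| - 2 < s.
    rewrite -ltr_sqr ?nnegrE//; last by lra.
    by rewrite sE -tn; nra.
  (* The sign in front of the square root is opposite to that of t, which selects the smaller
     root. *)
  case: (ger0P t) t2 st ts => [_|_] t2 st ts.
  - exists ((t - s) / 2); first by rewrite gt_eqF//; lra.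
    by rewrite ger0_norm; [split; [lra|]|lra]; rewrite !expr2 in sE *; nra.
  - exists ((t + s) / 2); first by rewrite lt_eqF//; lra.
    by rewrite ler0_norm; [split; [lra|]|lra]; rewrite !expr2 in sE *; nra.
have [Q tQ] : exists Q, poly_trace 0 - t%:P = Q * ('X - E%:P).
  apply/factor_theorem; rewrite /root !hornerE horner_poly_trace subrr//.
pose D r a u := u - r%:C *: l2shift a u.
have DD u : D r q%:Z (D r (- q%:Z) u) = (- r)%:C *: (hpoly (poly_trace 0) u - t%:C *: u).
  apply: val_inj; apply/funext => n.
  change (u n - r%:C * u (n - q%:Z) - r%:C * (u (n + q%:Z) - r%:C * u (n + q%:Z - q%:Z)) =
    (- r)%:C * (hpoly (poly_trace 0) u n - t%:C * u n)).
  rewrite hpoly_trace addrK rmorphN.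
  have := congr1 (real_complex R) rt; rewrite rmorphD !rmorphM rmorph1/= => rtC.
  have {}rtC : r%:C ^+ 2 = t%:C * r%:C - 1 by rewrite -rtC addrK.
  ring: rtC.
have Qcomm u : hpoly (poly_trace 0) u - t%:C *: u = H (hpoly Q u) - E%:C *: hpoly Q u.
  transitivity (hpoly (poly_trace 0 - t%:P) u); first by rewrite hpolyD hpolyN hpolyC.
  by rewrite tQ mulrBr hpolyD hpolyN hpolyMX mulrC mul_polyC hpolyZ.
have Qcomm2 u : H (hpoly Q u) - E%:C *: hpoly Q u = hpoly Q (H u - E%:C *: u).
  by rewrite hpolyB hpoly_iterS hpolyZr.
have [K K0 KQ] := l2norm_hpoly Q.
(* K bounds Q(H), and inverting each of the two shift factors costs 1 / (1 - |r|). *)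
apply: (@resolvent_set_bijective _ _ _ (K * `|r| / (1 - `|r|) ^+ 2)).
- move=> f; have [g1 g1E] := sub_shift_surj q%:Z ((- r)%:C *: f) r1.
  have [g gE] := sub_shift_surj (- q%:Z) g1 r1.
  exists (hpoly Q g); rewrite -Qcomm.
  have := DD g; rewrite /D gE g1E => /(congr1 (fun w => (- r)%:C^-1 *: w)).
  by rewrite !scalerA mulVf ?scale1r// fmorph_eq0 oppr_eq0.
move=> u.
have b1 := sub_shift_lower_bound (- q%:Z) r u.
have b2 := sub_shift_lower_bound q%:Z r (D r (- q%:Z) u).
rewrite [X in _ <= l2norm X]DD Qcomm Qcomm2 in b2.
have b3 := KQ (H u - E%:C *: u); move: b2.
rewrite l2normZ normc_real normrN => b2.
have r1' : 0 < 1 - `|r| by rewrite subr_gt0.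
rewrite mulrAC ler_pdivlMr ?exprn_gt0//.
have := ler_wpM2l (ltW r1') b1; have := ler_wpM2l (normr_ge0 r) b3.
by rewrite /D; lra.
Qed.
End PeriodicSchrodinger.

(** * The critical almost Mathieu operator *)

(** S comes without measurability, so the first inequality is monotonicity of the outer measure. *)
Lemma lebesgue_measure_cover (R : realType) n (a b : seq R) (S : set R) :
  (forall i, (i < n)%N -> a`_i <= b`_i) ->
  (forall E, S E -> exists2 i, (i < n)%N & a`_i <= E <= b`_i) ->
  (lebesgue_measure S <= (\sum_(i < n) (b`_i - a`_i))%:E)%E.
Proof.
move=> ab SE; pose I i := [set` `[a`_i, b`_i]].
apply: (@le_trans _ _ (lebesgue_measure (\big[setU/set0]_(i < n) I i))).
  apply: le_mu_ext => E /SE[i ilt Ei].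
  have EI : (E : R) \in `[a`_i, b`_i] by rewrite in_itv.
  by rewrite -bigcup_mkord; exists i.
apply: (@le_trans _ _ (\sum_(i < n) lebesgue_measure (I i))%E).
  by apply: Boole_inequality => i _; exact: measurable_itv.
rewrite -sumEFin; apply: lee_sum => i _.
rewrite /I lebesgue_measure_itv/= lte_fin; case: ltP => //.
by rewrite lee_fin subr_ge0 ab.
Qed.

(** * The unit circle and primitive roots of unity *)

Section UnitComplex.
Variable R : realType.
Implicit Types x y : R.

Definition cis x : R[i] := cos x +i* sin x.

Lemma cisD x y : cis (x + y) = cis x * cis y.
Proof. by rewrite /cis cosD sinD; apply/eqP; rewrite eq_complex/= !eqxx /= addrC eqxx. Qed.

Lemma cis0 : cis 0 = 1. Proof. by rewrite /cis cos0 sin0. Qed.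

Lemma cis_neq0 x : cis x != 0.
Proof.
apply/eqP => cx; have := cisD x (- x); rewrite subrr cis0 cx mul0r.
by move/eqP; rewrite oner_eq0.
Qed.

Lemma cisV x : (cis x)^-1 = cis (- x).
Proof.
apply: (mulfI (cis_neq0 x)).
by rewrite -cisD subrr cis0 divff// cis_neq0.
Qed.

Lemma cisX x n : cis x ^+ n = cis (x * n%:R).
Proof.
elim: n => [|n IH]; first by rewrite mulr0 cis0.
by rewrite exprS IH -cisD -{1}(mulr1 x) -mulrDr -natr1 addrC.
Qed.

Lemma cisDV x : cis x + (cis x)^-1 = (2 * cos x)%:C.
Proof.
rewrite cisV /cis cosN sinN; apply/eqP; rewrite eq_complex/= subrr eqxx andbT.
by apply/eqP; ring.
Qed.

Lemma conj_cis x : Num.conj (cis x) = (cis x)^-1.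
Proof. by rewrite cisV /cis cosN sinN. Qed.

Lemma cis2pin n : cis (2 * pi * n%:R) = 1.
Proof.
rewrite -cisX; suff -> : cis (2 * pi) = 1 by rewrite expr1n.
by rewrite /cis mulr_natl cos2pi sin2pi.
Qed.

Lemma cis_pi : cis pi = -1.
Proof. by rewrite /cis cospi sinpi; apply/eqP; rewrite eq_complex/= oppr0 !eqxx. Qed.

Lemma sin_le_id x : 0 <= x -> sin x <= x.
Proof.
rewrite le_eqVlt => /orP[/eqP <-|x0]; first by rewrite sin0.
have [c _] := @MVT R sin cos 0 x x0 (fun c _ => is_derive_sin c)
  (continuous_subspaceT (@continuous_sin R)).
by rewrite sin0 !subr0 => ->; rewrite ler_piMl ?cos_le1// ltW.
Qed.

(** By the half-angle formula the modulus is 2 sin(x/2), and sin(x/2) <= x/2. *)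
Lemma normc_1Bcis x : 0 <= x <= pi -> normc (1 - cis x) <= x.
Proof.
move=> /andP[x0 xpi].
have -> : 1 - cis x = (1 - cos x) -i* sin x.
  by apply/eqP; rewrite eq_complex/= sub0r !eqxx.
rewrite -[leRHS]ger0_norm// -sqrtr_sqr ler_sqrt ?sqr_ge0// sqrrN.
have xE : x = (x / 2) *+ 2 by rewrite -mulr_natr divfK.
have s0 : 0 <= sin (x / 2) by apply: sin_ge0_pi; lra.
have s1 : sin (x / 2) <= x / 2 by apply: sin_le_id; lra.
have := cos2Dsin2 x; have := cos2Dsin2 (x / 2).
have : cos x = cos (x / 2) ^+ 2 *+ 2 - 1 by rewrite -cos_mulr2n -xE.
move: (cos x) (sin x) (cos (x / 2)) (sin (x / 2)) s0 s1 => c s c' s' s0 s1 -> cs' cs.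
nra.
Qed.

Lemma cis_neq1 x : 0 < x < 2 * pi -> cis x != 1.
Proof.
move=> /andP[x0 xpi]; apply/eqP => -[cx _].
have xE : x = (x / 2) *+ 2 by rewrite -mulr_natr divfK.
have s0 : 0 < sin (x / 2) by apply: sin_gt0_pi; lra.
have := cos2Dsin2 (x / 2).
move: cx; rewrite xE cos_mulr2n -xE => cx cs.
nra.
Qed.

(** Only the residue of p (i + 1) modulo q matters. For i + 1 < q it is nonzero by coprimality, so
    the remaining angle lies strictly between 0 and 2 pi. *)
Lemma cis_primitive (p q : nat) : (0 < q)%N -> coprime p q ->
  q.-primitive_root (cis (2 * pi * (p%:R / q%:R))).
Proof.
move=> q0 pq; apply/andP; split=> //; apply/forallP => i.
have q0R : q%:R != 0 :> R by rewrite pnatr_eq0 -lt0n.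
rewrite unity_rootE cisX; apply/eqP.
have -> : 2 * pi * (p%:R / q%:R) * i.+1%:R =
    2 * pi * ((p * i.+1) %/ q)%:R + 2 * pi * (((p * i.+1) %% q)%:R / q%:R) :> R.
  have := congr1 (fun k => k%:R : R) (divn_eq (p * i.+1) q).
  rewrite /= natrD !natrM => h.
  by rewrite -mulrDr -mulrA; congr (_ * _); rewrite mulrAC h; field.
rewrite cisD cis2pin mul1r.
have [qi|qi] := eqVneq i.+1 q.
  by rewrite qi modnMl mul0r mulr0 cis0 eqxx.
apply/negbTE/cis_neq1.
have iq : (i.+1 < q)%N by rewrite ltn_neqAle qi ltn_ord.
have m0 : (0 < (p * i.+1) %% q)%N.
  rewrite lt0n -/(dvdn _ _) Gauss_dvdr 1?coprime_sym//.
  by apply/negP => /(dvdn_leq (ltn0Sn _)); rewrite leqNgt iq.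
have pi2 : 0 < 2 * pi :> R by rewrite mulr_gt0// pi_gt0.
rewrite mulr_gt0 ?divr_gt0 ?ltr0n//= gtr_pMr//.
by rewrite ltr_pdivrMr ?ltr0n// mul1r ltr_nat ltn_mod.
Qed.

End UnitComplex.

Section CriticalAlmostMathieu.
Variables (R : realType) (p q : nat).
Hypotheses (q0 : (0 < q)%N) (pq : coprime p q).
Let alpha : R := p%:R / q%:R.
Let om : R[i] := cis (2 * pi * alpha).
Let om_prim : q.-primitive_root om := cis_primitive R q0 pq.
Let q0R : q%:R != 0 :> R. Proof. by rewrite pnatr_eq0 -lt0n. Qed.

Let potential (theta : R) (n : int) : R :=
  2 * cos (2 * pi * (alpha * n%:~R + theta)).

Lemma cosD2pin (x : R) (n : nat) : cos (x + 2 * pi * n%:R) = cos x.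
Proof. by have := cisD x (2 * pi * n%:R); rewrite cis2pin mulr1 => -[-> _]. Qed.

Let potential_periodic theta n : potential theta (n + q%:Z) = potential theta n.
Proof.
rewrite /potential -(cosD2pin (2 * pi * (alpha * n%:~R + theta)) p).
by congr (2 * cos _); rewrite intrD /alpha /=; field.
Qed.

Lemma l2norm_le_scale (c : R) (u w : l2Z R) : 0 <= c ->
  (forall n, normc (w n) <= c * normc (u n)) -> l2norm w <= c * l2norm u.
Proof.
move=> c0 wu; rewrite -ler_sqr ?nnegrE ?mulr_ge0 ?l2norm_ge0//.
rewrite exprMn -lee_fin [leRHS]EFinM !l2norm_sq; apply: sqsum_le; first exact: sqr_ge0.
by move=> n; rewrite -exprMn ler_sqr ?nnegrE ?mulr_ge0 ?normc_pos.
Qed.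

Lemma l2norm_amo_le theta (u : l2Z R) : l2norm (amo alpha theta u) <= 4 * l2norm u.
Proof.
pose w := amo alpha theta u - (l2shift (- 1) u + l2shift 1 u).
have wE n : w n = (potential theta n)%:C * u n.
  change (u (n - 1) + u (n + 1) + (potential theta n)%:C * u n -
    (u (n - 1) + u (n + 1)) = (potential theta n)%:C * u n).
  by rewrite addrAC subrr add0r.
have -> : amo alpha theta u = w + (l2shift (- 1) u + l2shift 1 u) by rewrite subrK.
have w2 : l2norm w <= 2 * l2norm u.
  apply: l2norm_le_scale => // n; rewrite wE normc_realM ler_wpM2r ?normc_pos//.
  by rewrite normrM ger0_norm// ler_piMr// cos_max.
have := l2norm_triangle w (l2shift (- 1) u + l2shift 1 u).
have := l2norm_triangle (l2shift (- 1) u) (l2shift 1 u).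
by rewrite !l2norm_shift; lra.
Qed.

Lemma amo_spectrum_trace theta E : spectrum (amo alpha theta) E%:C ->
  `|trace_at (potential theta) q E| <= 2.
Proof.
move=> sE; rewrite leNgt; apply/negP => t2; apply: sE.
by apply: (resolvent_set_trace_gt2 (potential_periodic theta) _ (l2norm_amo_le theta) t2).
Qed.

(** Take the point of the circle of radius r with real part a/2. For r = 1 it turns a trace of
    modulus at most 2 into a Bloch multiplier. *)
Lemma complex_unit_sqrt (a r : R) : `|a| <= 2 * r ->
  exists2 z : R[i], normc z ^+ 2 = r ^+ 2 & z + Num.conj z = a%:C.
Proof.
move=> ar; exists ((a / 2) +i* Num.sqrt (r ^+ 2 - (a / 2) ^+ 2)).
  rewrite normc_ReIm /= sqr_sqrtr ?subr_ge0; first by rewrite addrC subrK.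
  rewrite -[leLHS]real_normK ?num_real// ler_sqr ?nnegrE//.
    by rewrite normrM [`|2^-1|]ger0_norm// ler_pdivrMr// mulrC.
  by rewrite -(pmulr_rge0 r (ltr0n _ 2)) (le_trans _ ar).
by apply/eqP; rewrite eq_complex/= subrr eqxx andbT; apply/eqP; field.
Qed.

Lemma mul_conj_normc (z : R[i]) : z * Num.conj z = (normc z ^+ 2)%:C.
Proof.
rewrite normc_ReIm; case: z => a b; apply/eqP; rewrite eq_complex/=.
by apply/andP; split; apply/eqP; ring.
Qed.

Lemma normc1_neq0 (z : R[i]) : normc z = 1 -> z != 0.
Proof. by move=> z1; apply: contra_eqN z1 => /eqP ->; rewrite normc0 eq_sym oner_eq0. Qed.

Lemma normc1_conj (z : R[i]) : normc z = 1 -> Num.conj z = z^-1.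
Proof.
move=> z1; apply: (mulfI (normc1_neq0 z1)).
by rewrite mul_conj_normc z1 expr1n divff// normc1_neq0.
Qed.

Lemma normcX (z : R[i]) n : normc (z ^+ n) = normc z ^+ n.
Proof. by elim: n => [|n IH]; rewrite ?normc1// !exprS normcM IH. Qed.

Lemma normc_cis (x : R) : normc (cis x) = 1.
Proof. by rewrite /= cos2Dsin2 sqrtr1. Qed.

Lemma conj_chi_b (mu : R[i]) n : normc mu = 1 ->
  Num.conj (chi_b om mu n) = chi_c om mu n.
Proof.
move=> mu1; rewrite /chi_b /chi_c rmorphD rmorph1 rmorphM fmorphV rmorphXn/=.
by rewrite normc1_conj// conj_cis exprVn invrK mulrC.
Qed.

(** A Bloch solution of multiplier x, |x| = 1, is dualized at some mu with mu^q kappa = x. There the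
    trace is twice the real part of a unit number times 1 - (-mu)^q, hence at most 4 in modulus, and
    it is the same at every mu. *)
Lemma chi_trace_bounded theta E : spectrum (amo alpha theta) E%:C ->
  exists2 d : R, `|d| <= 4 & forall mu, mu != 0 -> chi_trace q om E%:C mu = d%:C.
Proof.
move=> /amo_spectrum_trace; set t := trace_at _ _ _ => t2.
have [x x1 xt] : exists2 x : R[i], normc x ^+ 2 = 1 ^+ 2 & x + Num.conj x = t%:C.
  by apply: complex_unit_sqrt; rewrite mulr1.
have {}x1 : normc x = 1.
  by apply/eqP; rewrite -(eqrXn2 (n := 2))// ?normc_pos//; apply/eqP.
pose T (k : nat) : 'M[R[i]]_2 :=
  mx2 (E%:C - (potential theta k%:Z)%:C) (-1) 1 0.
have trT : \tr (transfer T q) = t%:C.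
  rewrite /t /trace_at -[RHS]/(real_complex R _) -trace_map_mx map_transfer.
  congr mxtrace; apply: eq_transfer => i _.
  by rewrite map_mx2 /T rmorphB rmorphN rmorph1 rmorph0.
have [w w0 Tw] : exists2 w : 'cV_2, w != 0 & transfer T q *m w = x *: w.
  apply: mx2_eigenvector; rewrite trT -xt (normc1_conj x1).
  rewrite det_transfer big1 => [|i _]; last by rewrite det_mx2; ring.
  by field; exact: normc1_neq0.
have Tq i : T (i + q)%N = T i by rewrite /T PoszD potential_periodic.
have per := transfer_eigen_periodic Tq Tw.
pose u k := (transfer T k *m w) 1 0.
have TE m (r : 'cV[R[i]]_2) : T m *m r = \col_i
    (if i == 0 then (E%:C - (potential theta m%:Z)%:C) * r 0 0 - r 1 0 else r 0 0).
  apply/matrixP => [[[|[|?]] ?] j] //;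
    rewrite !mxE big_ord_recl big_ord1 !mxE/= (ord1 j) ?mulN1r ?mul1r ?mul0r ?addr0.
    by congr (_ * r _ _ - r _ _); apply: val_inj.
  by congr (r _ _); apply: val_inj.
(* u_m is the lower entry of the state, so the equation centred at u_(m+1) involves the potential at
   site m; subtracting alpha makes V_(m+1) the phase at that site. *)
pose V0 := cis (2 * pi * (theta - alpha)).
have VE m : V0 * om ^+ m.+1 = cis (2 * pi * (alpha * m%:R + theta)).
  by rewrite /V0 /om cisX -cisD; congr cis; rewrite -natr1; ring.
have uE m : E%:C * u m.+1 = u m.+2 + u m +
    (V0 * om ^+ m.+1 + (V0 * om ^+ m.+1)^-1) * u m.+1.
  rewrite VE cisDV -/(potential theta m%:Z) /u !transferS -!mulmxA.
  by move: (transfer T m *m w) => s; rewrite !TE !mxE/=; ring.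
have uq m : u (m + q)%N = x * u m by rewrite /u per mxE.
have u0 : exists m, u m != 0.
  have [w1|w1] := eqVneq (w 1 0) 0; last by exists 0%N; rewrite /u mul1mx.
  exists 1%N; rewrite /u transferS mulmx1 TE mxE/=; apply: contra w0 => /eqP w00.
  apply/eqP/matrixP => [[[|[|?]] ?] j] //; rewrite mxE (ord1 j).
    by rewrite -w00; congr (w _ _); apply: val_inj.
  by rewrite -w1; congr (w _ _); apply: val_inj.
have V00 : V0 != 0 := cis_neq0 _.
have y1 : normc (V0 ^+ q) = 1 by rewrite normcX normc_cis expr1n.
have y0 : V0 ^+ q != 0 := normc1_neq0 y1.
pose kappa := \prod_(j < q) (V0 * om ^+ j.+1).
have k1 : normc kappa = 1.
  apply: (big_ind (fun z : R[i] => normc z = 1)) => [|a b a1 b1|j _].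
  - exact: normc1.
  - by rewrite normcM a1 b1 mulr1.
  - by rewrite VE normc_cis.
have [D DE] := chi_trace_const q0 om_prim E%:C.
suff [d d4 Dd] : exists2 d : R, `|d| <= 4 & D = d%:C.
  by exists d => // mu mun; rewrite DE.
have bloch mu : mu != 0 -> mu ^+ q * kappa = x ->
    exists psi, chiral_bloch q om E%:C mu (V0 ^+ q) psi.
  by move=> mun; exact: (landau_to_chiral q0 om_prim V00 mun uE uq u0).
(* This is the case where 1 - (-mu)^q vanishes; then mu = -1 satisfies the condition on mu, and the
   trace is 0. *)
have [xk|xk] := eqVneq x ((-1) ^+ q * kappa).
  have N10 : -1 != 0 :> R[i] by rewrite oppr_eq0 oner_eq0.
  have [psi psiB] := bloch _ N10 (esym xk).
  exists 0; first by rewrite normr0.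
  by rewrite -(DE _ N10) (chiral_bloch_trace0 q0 om_prim y0 psiB).
pose mu := q.-root (x / kappa).
have muq : mu ^+ q = x / kappa by rewrite /mu rootCK.
have mu1 : normc mu = 1.
  apply/eqP; rewrite -(pexpr_eq1 q0 (normc_pos _)) -normcX muq normcM normcV.
  by rewrite x1 k1 divr1.
have mun := normc1_neq0 mu1.
have [psi psiB] : exists psi, chiral_bloch q om E%:C mu (V0 ^+ q) psi.
  by apply: bloch => //; rewrite muq divfK// normc1_neq0.
have b0 : \prod_(n < q) chi_b om mu n != 0.
  rewrite (prod_chi_b q0 om_prim mun) subr_eq0 eq_sym; apply: contra xk.
  rewrite (exprNn mu) muq => /eqP e1; apply/eqP.
  have s2 : (-1) ^+ q * (-1) ^+ q = 1 :> R[i] by rewrite -exprMn mulrNN mulr1 expr1n.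
  transitivity ((-1) ^+ q * ((-1) ^+ q * (x / kappa)) * kappa).
    by rewrite mulrA s2 mul1r divfK// normc1_neq0.
  by rewrite e1 mulr1.
have := chiral_bloch_trace q0 om_prim mun y0 b0 psiB.
set beta := \prod_(n < q) chi_b _ _ _ in b0 *.
have -> : \prod_(n < q) chi_c om mu n = Num.conj beta.
  by rewrite rmorph_prod; apply: eq_bigr => n _; exact/esym/conj_chi_b.
rewrite -(normc1_conj y1) mulrC -rmorphM mulrC DE// => ->.
have : normc (V0 ^+ q * beta) <= 2.
  rewrite normcM y1 mul1r /beta (prod_chi_b q0 om_prim mun).
  apply: le_trans (normcD_le _ _) _.
  by rewrite normc1 normcN normcX normcN mu1 expr1n.
move=> /(le_trans (Re_le_normc _)).
move: (V0 ^+ q * beta) => z z2; exists (2 * complex.Re z).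
  by rewrite normrM ger0_norm//; lra.
by case: z {z2} => a b; apply/eqP; rewrite eq_complex/= subrr eqxx andbT; apply/eqP; ring.
Qed.

(** As (-mu0)^q = -1, the product of the b_n reaches 2, its largest modulus on the unit circle,
    while b_0 = 1 - exp(i pi/q) stays small. *)
Let mu0 : R[i] := - cis (pi / q%:R).

Let normc_mu0 : normc mu0 = 1. Proof. by rewrite normcN normc_cis. Qed.

Let mu0_q : (- mu0) ^+ q = -1.
Proof. by rewrite opprK cisX divfK// cis_pi. Qed.

(** At mu0 the products of the b_n and of the c_n both equal 2, so the trace formula reads d = 2 (y
    + 1/y), which has a solution with |y| = 1 because |d| <= 4. *)
Lemma amo_spectrum_eigen theta E :
  spectrum (amo alpha theta) E%:C ->
  exists (y : R[i]) (v : 'rV_q.-1.+1), [/\ normc y = 1, v != 0 &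
    v *m (jacobi_chain q.-1 (chi_b om mu0) +
          jacobi_wrap q.-1 (chi_b om mu0 0%N * y)) = E%:C *: v].
Proof.
move=> /chi_trace_bounded[d d4 dE].
have mu00 := normc1_neq0 normc_mu0.
have beta : \prod_(n < q) chi_b om mu0 n = 2.
  by rewrite (prod_chi_b q0 om_prim mu00) mu0_q opprK.
have gamma : \prod_(n < q) chi_c om mu0 n = 2.
  by rewrite (prod_chi_c om_prim mu00) -invrN exprVn mu0_q invrN invr1 opprK.
have [y y1 yd] : exists2 y : R[i], normc y ^+ 2 = 1 ^+ 2 & y + Num.conj y = (d / 2)%:C.
  apply: complex_unit_sqrt; rewrite mulr1 normrM [`|2^-1|]ger0_norm//.
  by rewrite ler_pdivrMr// -natrM.
have {}y1 : normc y = 1.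
  by apply/eqP; rewrite -(eqrXn2 (n := 2))// ?normc_pos//; apply/eqP.
have y0 := normc1_neq0 y1.
have [psi [psiE psiq psi0]] : exists psi, chiral_bloch q om E%:C mu0 y psi.
  apply: (chiral_bloch_exists q0 om_prim mu00 y0).
    by rewrite beta pnatr_eq0.
  rewrite beta gamma dE// -(normc1_conj y1) mulrC -mulrDr yd.
  by rewrite rmorphM fmorphV rmorph_nat/= mulrCA divff ?mulr1 ?pnatr_eq0.
have qE : q.-1.+1 = q by rewrite prednK.
exists y, (\row_i psi i.+1); split=> //.
  have [m mq pm] := quasi_periodic_neq0 q0 psiq psi0.
  (* The eigenvector uses the sites 1 to q, so a nonzero value at site 0 is moved to site q. *)
  have [k kq pk] : exists2 k, (k < q.-1.+1)%N & psi k.+1 != 0.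
    case: m mq pm => [|m] mq pm; last by exists m => //; rewrite qE ltnW.
    by exists q.-1; rewrite ?leqnn// qE -[q]add0n psiq mulf_neq0.
  by apply: contra pk => /eqP/rowP/(_ (Ordinal kq)); rewrite !mxE => /= ->.
apply: jacobi_wrapped_eigen.
- by move=> k; rewrite psiE -conj_chi_b.
- by rewrite qE.
- by rewrite qE -[q in LHS]add0n (chi_bDq om_prim).
- by rewrite mul_conj_normc y1 expr1n.
Qed.

Lemma lebesgue_amo_spectrum_le :
  (lebesgue_measure (amo_spectrum alpha) <= (4 * pi / q%:R : R)%:E)%E.
Proof.
set b := chi_b om mu0; set b0 := b 0%N.
have nb : `|b0| \is Num.real by exact: normr_real.
have [lo [hi [_ _ lohi sum_lohi band]]] := spectral_bands
  (jacobi_bound_herm q.-1 b (rpredNr nb)) (jacobi_bound_herm q.-1 b nb)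
  (fun v => le_trans (jacobi_wrapped_ge b b0 v) (jacobi_wrapped_le b b0 v)).
apply: (@le_trans _ _ (\sum_(i < q.-1.+1) (hi`_i - lo`_i))%:E).
  apply: lebesgue_measure_cover => // E [theta _ /amo_spectrum_eigen[y [v [y1 v0 vE]]]].
  (* The multiplier y does not change the modulus of the corner, so one pair of bounds serves all E
     and theta. *)
  have zE : `|b0 * y| = `|b0|.
    by rewrite normrM [`|y|](_ : _ = (normc y)%:C)// y1 mulr1.
  apply: (band _ _ v (jacobi_wrapped_herm _ _ _) _ _ vE v0) => w.
    by rewrite -zE; exact: jacobi_wrapped_ge.
  by rewrite -zE; exact: jacobi_wrapped_le.
rewrite lee_fin.
have : (\sum_(i < q.-1.+1) (hi`_i - lo`_i))%:C = (4 * normc b0)%:C.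
  rewrite sum_lohi trace_jacobi_bound rmorphM rmorph_nat; congr (_ * _).
move=> /complexI ->.
rewrite -mulrA ler_wpM2l// /b0 /b /chi_b expr0 divr1 /mu0 normc_1Bcis//.
rewrite divr_ge0 ?pi_ge0//= ler_pdivrMr ?ltr0n//.
by rewrite ler_peMr ?pi_ge0// ler1n.
Qed.

End CriticalAlmostMathieu.

Theorem theorem1 (R : realType) (p0 q0 : nat)
    (hp0 : (0 < p0)%N) (hq0 : (0 < q0)%N) (hpq : coprime p0 q0) :
  (lebesgue_measure (amo_spectrum (p0%:R / q0%:R : R))
     <= (4 * pi / q0%:R : R)%:E)%E.
Proof. exact: lebesgue_amo_spectrum_le. Qed.
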